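(* Assume the following hypothesis ($\text{SYM}\circ\text{AND}$ Hypothesis): there are constants $c, k > 1$ such that for all sufficiently large $n$, there is a function $f:\{0,1\}^n \to \{0,1\}$ computable by a $\mathsf{TC}^0$ circuit of depth $c$ with at most $\tilde{O}(n)$ gates, each of fan-in $\tilde{O}(n)$, such that $f$ does not have a $\text{SYM}\circ\text{AND}$ circuit of size $\exp(O(n^{1/k}))$. Then there is a fixed $\alpha > 0$ such that for every modulus $m$ and every depth $d$, every depth-$d$ $\mathsf{ACC}^0[m]$ circuit computing the MAJORITY function on $n$ inputs requires size at least $\exp(n^{\alpha/(rd)})$ for all sufficiently large $n$, where $r$ is the number of distinct prime factors of $m$.
   Context: A $\mathsf{TC}^0$ circuit consists of MAJORITY and NOT gates. A $\text{SYM}\circ\text{AND}$ circuit is a depth-two circuit whose output gate computes an arbitrary symmetric function (one depending only on the number of ones among its inputs) of its inputs, each of which is an AND of input variables and their negations; its size is the number of AND gates. An $\mathsf{ACC}^0[m]$ (also written $\mathsf{AC}^0[m]$) circuit consists of unbounded fan-in AND, OR, NOT and $\text{MOD}_m$ gates, where a $\text{MOD}_m$ gate outputs $1$ iff the sum of its inputs is divisible by $m$. MAJORITY on $n$ inputs outputs $1$ iff at least half the inputs are $1$. $\tilde{O}(\cdot)$ hides polylogarithmic factors in $n$. *)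

(* Defs.v *)
From HB Require Import structures.
From mathcomp Require Import all_boot all_order all_algebra.
From mathcomp Require Import all_classical all_reals all_analysis.

Set Implicit Arguments.
Unset Strict Implicit.
Unset Printing Implicit Defensive.

Import Order.TTheory GRing.Theory Num.Theory.

Local Open Scope classical_set_scope.
Local Open Scope ring_scope.

(* A circuit on n inputs is a list of gates in topological order.  Nodes are
   numbered: node i < n is the input x_i and node n + j is the j-th gate; a
   gate is given with the nodes that feed it (repetitions are allowed, i.e.
   parallel wires, and are counted with multiplicity). *)
Inductive gate :=
  | AND of seq nat
  | OR of seq nat
  | NOT of nat
  | MOD of nat & seq nat
  | MAJ of seq nat.

Definition wires (g : gate) : seq nat :=
  match g with
  | AND ws | OR ws | MOD _ ws | MAJ ws => ws
  | NOT w => [:: w]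
  end.

Definition majority (s : seq bool) : bool := (size s <= (count id s).*2)%N.

Definition gate_value (v : nat -> bool) (g : gate) : bool :=
  match g with
  | AND ws => all v ws
  | OR ws => has v ws
  | NOT w => ~~ v w
  | MOD m ws => (m %| count v ws)%N
  | MAJ ws => majority (map v ws)
  end.

(* k is the number of nodes preceding the first gate of gs *)
Fixpoint topological (k : nat) (gs : seq gate) : bool :=
  if gs is g :: gs' then
    all (fun w => w < k)%N (wires g) && topological k.+1 gs'
  else true.

Record circuit (n : nat) := Circuit {
  gates : seq gate;
  output : nat;
  gates_topological : topological n gates;
  output_node : (output < n + size gates)%N
}.

Definition circuit_size n (C : circuit n) : nat := size (gates C).

Definition node_values n (C : circuit n) (x : n.-tuple bool) : seq bool :=
  foldl (fun vs g => rcons vs (gate_value (nth false vs) g)) x (gates C).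

Definition circuit_value n (C : circuit n) (x : n.-tuple bool) : bool :=
  nth false (node_values C x) (output C).

Definition computes n (C : circuit n) (f : n.-tuple bool -> bool) : Prop :=
  forall x, circuit_value C x = f x.

(* NOT gates count towards both the size and the depth. *)
Definition node_depths n (C : circuit n) : seq nat :=
  foldl (fun ds g => rcons ds (\max_(w <- wires g) nth 0%N ds w).+1)
        (nseq n 0%N) (gates C).

Definition circuit_depth n (C : circuit n) : nat :=
  nth 0%N (node_depths C) (output C).

Definition TC0_gate (g : gate) : bool :=
  match g with MAJ _ | NOT _ => true | _ => false end.

Definition ACC0_gate (m : nat) (g : gate) : bool :=
  match g with
  | AND _ | OR _ | NOT _ => true
  | MOD q _ => q == m
  | MAJ _ => false
  end.

Definition TC0_circuit n (C : circuit n) : bool := all TC0_gate (gates C).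

Definition ACC0_circuit m n (C : circuit n) : bool :=
  all (ACC0_gate m) (gates C).

Definition fan_in_le n (C : circuit n) (b : nat) : bool :=
  all (fun g => size (wires g) <= b)%N (gates C).

(* The literal (i, true) is x_i and (i, false) is its negation. *)
Record sym_and (n : nat) := SymAnd {
  terms : seq (seq ('I_n * bool));
  sym_gate : nat -> bool
}.

Definition sym_and_size n (S : sym_and n) : nat := size (terms S).

Definition term_value n (x : n.-tuple bool) (t : seq ('I_n * bool)) : bool :=
  all (fun l => tnth x l.1 == l.2) t.

Definition sym_and_value n (S : sym_and n) (x : n.-tuple bool) : bool :=
  sym_gate S (count (term_value x) (terms S)).

Definition sym_and_computes n (S : sym_and n) (f : n.-tuple bool -> bool) :
    Prop :=
  forall x, sym_and_value S x = f x.

(* t(n) = O~(n) *)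
Definition quasilinear (R : realType) (t : nat -> nat) : Prop :=
  exists (A : R) (e : nat),
    \forall n \near \oo, (t n)%:R <= A * n%:R * ln (n%:R : R) ^+ e.

(* "No circuit of size exp(O(n^{1/k}))" means that, for every constant B, none
   of size at most exp(B n^{1/k}) once n is large enough (depending on B). *)
Definition SYM_AND_hypothesis (R : realType) : Prop :=
  exists (c : nat) (k : R) (f : forall n, n.-tuple bool -> bool)
         (s w : nat -> nat),
    [/\ (1 < c)%N /\ 1 < k,
        quasilinear R s /\ quasilinear R w,
        \forall n \near \oo, exists C : circuit n,
          [/\ TC0_circuit C, (circuit_depth C <= c)%N,
              (circuit_size C <= s n)%N, fan_in_le C (w n) &
              computes C (@f n)] &
        forall B : R, \forall n \near \oo,
          ~ exists S : sym_and n,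
              (sym_and_size S)%:R <= expR (B * n%:R `^ k^-1) /\
              sym_and_computes S (@f n)].

Definition MAJORITY n (x : n.-tuple bool) : bool := majority x.

(* Main.v *)
(** The heart of the matter is the depth reduction of Chen and Papakonstantinou:
    a depth-[D] circuit with AND, OR, NOT and MOD_m gates whose size is at most
    [2 ^ K] is computed by a SYM of AND's of size [2 ^ (c K) ^ O(r D)].

    AND and OR gates are replaced by tests [p %| sum of a random subset]
    (Razborov-Smolensky), and a majority vote over few seeds, found greedily,
    makes the result correct on every input.  A MOD_m gate is a product of tests
    [p %| 'C(sum of the inputs, p ^ j)], by Lucas.  The function is then some
    [phi (F x)], where the integer polynomial [F] in the tests of the top level
    has weight at most [2 ^ B] and degree at most [B], and the levels are
    eliminated from the top, one prime divisor [p] of [m] at a time.  First a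
    product of tests modulo [p] becomes an integer combination of single tests
    (a Fourier expansion over F_p), and only then is each test replaced by a
    modulus-amplifying polynomial of degree [O(B)].  Because the products are
    removed beforehand, [B] is multiplied by [O(K)] rather than squared, so that
    the exponent stays linear in [r D].

    If MAJORITY had small circuits of depth [d] for some large [n], they could
    be substituted for the majority gates of the hard TC0 function on [sqrt n]
    inputs, and depth reduction would contradict its hardness. *)

Require Import Defs.
From mathcomp Require Import all_classical all_reals all_analysis.
From mathcomp Require Import all_boot all_order all_algebra all_field.
From mathcomp Require Import zify ring lra.

Import Order.TTheory GRing.Theory Num.Theory.

Local Open Scope ring_scope.

(** * Integer polynomials in Boolean functions *)

Section BoundedPolynomials.
Set Implicit Arguments.
Unset Strict Implicit.
Variable X : finType.
Local Notation fn := {ffun X -> bool}.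
Implicit Types (F H Z : X -> int) (G : fn -> Prop) (t : seq fn).

Definition monomial t (x : X) : int := (all (fun g : fn => g x) t)%:R.

Definition signed_sum (s : seq (bool * seq fn)) (x : X) : int :=
  \sum_(u <- s) (-1) ^+ u.1 * monomial u.2 x.

(** [W] counts signed monomials with repetition, so it bounds the sum of the absolute values of the
    coefficients and, tests being Boolean, the values of [F]; [T] bounds the degree. *)
Definition bounded_poly G (W T : nat) F : Prop :=
  exists s : seq (bool * seq fn),
    [/\ (size s <= W)%N,
        forall u, u \in s -> (size u.2 <= T)%N /\ (forall g, g \in u.2 -> G g)
      & F =1 signed_sum s].

Lemma bounded_poly_weaken G G' W W' T T' F F' :
  (forall g, G g -> G' g) -> (W <= W')%N -> (T <= T')%N -> F =1 F' ->
  bounded_poly G W T F -> bounded_poly G' W' T' F'.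
Proof.
move=> sG leW leT eF [s [sz hs es]]; exists s; split=> [|u us|x].
- exact: leq_trans sz leW.
- have [h1 h2] := hs u us; split; first exact: leq_trans h1 leT.
  by move=> g gu; apply/sG/h2.
- by rewrite -eF es.
Qed.

Lemma bounded_poly_monomial G T t :
  (size t <= T)%N -> (forall g, g \in t -> G g) -> bounded_poly G 1 T (monomial t).
Proof.
move=> st tG; exists [:: (false, t)]; split=> // [u|x].
  by rewrite inE => /eqP ->.
by rewrite /signed_sum big_seq1 mul1r.
Qed.

Lemma bounded_poly_atom G T (g : fn) :
  (0 < T)%N -> G g -> bounded_poly G 1 T (fun x => (g x)%:R).
Proof.
move=> T0 gG.
apply: (@bounded_poly_weaken G G 1 1 T T (monomial [:: g])) => //.
  by move=> x; rewrite /monomial /= andbT.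
by apply: bounded_poly_monomial => // h; rewrite inE => /eqP ->.
Qed.

Lemma bounded_poly1 G T : bounded_poly G 1 T (fun=> 1).
Proof.
by apply: (@bounded_poly_weaken G G 1 1 T T (monomial [::])) => //;
  apply: bounded_poly_monomial.
Qed.

Lemma bounded_poly0 G W T : bounded_poly G W T (fun=> 0).
Proof. by exists [::]; split=> // x; rewrite /signed_sum big_nil. Qed.

Lemma bounded_polyD G W1 W2 T F1 F2 :
  bounded_poly G W1 T F1 -> bounded_poly G W2 T F2 ->
  bounded_poly G (W1 + W2) T (fun x => F1 x + F2 x).
Proof.
move=> [s1 [z1 h1 e1]] [s2 [z2 h2 e2]]; exists (s1 ++ s2); split=> [|u|x].
- by rewrite size_cat leq_add.
- by rewrite mem_cat => /orP[/h1|/h2].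
- by rewrite e1 e2 /signed_sum big_cat.
Qed.

Lemma bounded_polyN G W T F :
  bounded_poly G W T F -> bounded_poly G W T (fun x => - F x).
Proof.
move=> [s [z h e]]; exists [seq (~~ u.1, u.2) | u <- s].
split=> [|u /mapP[v /h hv ->]|x] //; first by rewrite size_map.
rewrite e /signed_sum big_map -sumrN; apply: eq_bigr => u _ /=.
by rewrite signrN mulNr.
Qed.

Lemma bounded_polyB G W1 W2 T F1 F2 :
  bounded_poly G W1 T F1 -> bounded_poly G W2 T F2 ->
  bounded_poly G (W1 + W2) T (fun x => F1 x - F2 x).
Proof. by move=> h1 h2; apply: bounded_polyD => //; apply: bounded_polyN. Qed.

Lemma bounded_polyMn G W T F n :
  bounded_poly G W T F -> bounded_poly G (n * W) T (fun x => F x *+ n).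
Proof.
move=> h; elim: n => [|n IH].
  apply: (@bounded_poly_weaken G G 0 _ T T (fun=> 0)) => //.
  exact: bounded_poly0.
rewrite mulSn.
apply: (bounded_poly_weaken (G := G) _ _ _ _ (bounded_polyD h IH)) => // x.
by rewrite mulrS.
Qed.

Lemma bounded_poly_sum (I : Type) (r : seq I) (P : pred I) G (W : I -> nat) T
    (F : I -> X -> int) :
  (forall i, P i -> bounded_poly G (W i) T (F i)) ->
  bounded_poly G (\sum_(i <- r | P i) W i) T (fun x => \sum_(i <- r | P i) F i x).
Proof.
move=> h; elim: r => [|i r IH].
  apply: (@bounded_poly_weaken G G 0 _ T T (fun=> 0)) => //.
    by move=> x; rewrite big_nil.
  exact: bounded_poly0.
case Pi : (P i); last first.
  apply: (bounded_poly_weaken _ _ _ _ IH) => //; first by rewrite big_cons Pi.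
  by move=> x; rewrite big_cons Pi.
apply: (bounded_poly_weaken (G := G) _ _ _ _ (bounded_polyD (h i Pi) IH)) => //.
  by rewrite big_cons Pi.
by move=> x; rewrite big_cons Pi.
Qed.

(** An induction principle: a bound [w] for scaled monomials adds up over the at most [W] terms of
    [F]. It serves once with [P] given by [bounded_poly], for substitution, and once with
    [cong_poly], where [c] is a power of a prime. *)
Lemma bounded_poly_linear (P : nat -> (X -> int) -> Prop) G W T w (c : int) F :
  (forall n n' F F', (n <= n')%N -> F =1 F' -> P n F -> P n' F') ->
  P 0%N (fun=> 0) ->
  (forall n n' F F', P n F -> P n' F' -> P (n + n')%N (fun x => F x + F' x)) ->
  (forall n F, P n F -> P n (fun x => - F x)) ->
  (forall t, (size t <= T)%N -> (forall g, g \in t -> G g) ->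
    P w (fun x => c * monomial t x)) ->
  bounded_poly G W T F -> P (W * w)%N (fun x => c * F x).
Proof.
move=> Pw P0 PD PN Pm [s [z h e]].
apply: (Pw (size s * w)%N _ (fun x => c * signed_sum s x)).
- by rewrite leq_mul2r z orbT.
- by move=> x; rewrite e.
elim: s h {z e} => [|u s IH] h.
  by apply: Pw P0 => // x; rewrite /signed_sum big_nil mulr0.
have [h1 h2] := h u (mem_head _ _).
have hu := Pm u.2 h1 h2.
have {}hu : P w (fun x => c * ((-1) ^+ u.1 * monomial u.2 x)).
  case: u.1 => /=; last by apply: Pw hu => // x; rewrite mul1r.
  by apply: Pw (PN _ _ hu) => // x; rewrite mulN1r mulrN.
have hs : P (size s * w)%N (fun x => c * signed_sum s x).
  by apply: IH => v vs; apply: h; rewrite inE vs orbT.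
apply: Pw (PD _ _ _ _ hu hs); first by rewrite mulSn.
by move=> x; rewrite /signed_sum big_cons mulrDr.
Qed.

Lemma bounded_poly_subst G G' W T w T' F :
  (forall t, (size t <= T)%N -> (forall g, g \in t -> G g) ->
    bounded_poly G' w T' (monomial t)) ->
  bounded_poly G W T F -> bounded_poly G' (W * w) T' F.
Proof.
move=> h hF.
have := @bounded_poly_linear (fun n H => bounded_poly G' n T' H) G W T w 1 F.
case/(_ _ _ _ _ _ hF) => //.
- move=> n n' F1 F2 le e; exact: bounded_poly_weaken.
- exact: bounded_poly0.
- by move=> n n' F1 F2; apply: bounded_polyD.
- by move=> n F1; apply: bounded_polyN.
- move=> t st tG; apply: (bounded_poly_weaken _ _ _ _ (h t st tG)) => //.
  by move=> x; rewrite mul1r.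
- by move=> s [z hs e]; exists s; split=> // x; rewrite -e mul1r.
Qed.

Lemma monomial_cat t1 t2 x :
  monomial (t1 ++ t2) x = monomial t1 x * monomial t2 x.
Proof. by rewrite /monomial all_cat -natrM mulnb. Qed.

Lemma monomial_cons (g : fn) t x : monomial (g :: t) x = (g x)%:R * monomial t x.
Proof. by rewrite /monomial /= -natrM mulnb. Qed.

Lemma bounded_polyM G W1 W2 T1 T2 F1 F2 :
  bounded_poly G W1 T1 F1 -> bounded_poly G W2 T2 F2 ->
  bounded_poly G (W1 * W2) (T1 + T2) (fun x => F1 x * F2 x).
Proof.
move=> [s1 [z1 h1 e1]] [s2 [z2 h2 e2]].
exists [seq (u.1 (+) v.1, u.2 ++ v.2) | u <- s1, v <- s2]; split=> [|w|x].
- by rewrite size_allpairs leq_mul.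
- case/allpairsP=> -[u v] /= [/h1[a1 b1] /h2[a2 b2] ->] /=; split.
    by rewrite size_cat leq_add.
  by move=> g; rewrite mem_cat => /orP[/b1|/b2].
- rewrite e1 e2 /signed_sum big_allpairs_dep mulr_suml; apply: eq_bigr => u _.
  rewrite mulr_sumr; apply: eq_bigr => v _ /=.
  by rewrite monomial_cat signr_addb mulrACA.
Qed.

Lemma bounded_polyX G W T F n :
  bounded_poly G W T F -> bounded_poly G (W ^ n) (T * n) (fun x => F x ^+ n).
Proof.
move=> h; elim: n => [|n IH]; first by rewrite muln0; apply: bounded_poly1.
rewrite expnS mulnS.
apply: (bounded_poly_weaken (G := G) _ _ _ _ (bounded_polyM h IH)) => // x.
by rewrite exprS.
Qed.

Lemma bounded_poly_norm G W T F x : bounded_poly G W T F -> `|F x| <= W%:R.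
Proof.
move=> [s [z _ e]]; rewrite e; apply: (@le_trans _ _ (size s)%:R).
  rewrite /signed_sum (le_trans (ler_norm_sum _ _ _)) //.
  rewrite -sum1_size natr_sum; apply: ler_sum => u _.
  by rewrite normrM normr_sign mul1r /monomial; case: (all _ _); rewrite ?normr0 ?normr1.
by rewrite ler_nat.
Qed.

(** * Congruences, modulus amplification and products of tests *)

Definition modular_fn (p : nat) Z : fn := [ffun x => (p%:Z %| Z x)%Z].

Definition cong_poly G (d : int) W T F : Prop :=
  exists H, bounded_poly G W T H /\ forall x, (d %| F x - H x)%Z.

Lemma cong_poly_weaken G d W W' T T' F F' :
  (W <= W')%N -> (T <= T')%N -> F =1 F' ->
  cong_poly G d W T F -> cong_poly G d W' T' F'.
Proof.
move=> leW leT eF [H [hH dH]]; exists H; split=> [|x].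
  exact: (bounded_poly_weaken _ _ _ _ hH).
by rewrite -eF.
Qed.

Lemma cong_polyD G d W1 W2 T F1 F2 :
  cong_poly G d W1 T F1 -> cong_poly G d W2 T F2 ->
  cong_poly G d (W1 + W2) T (fun x => F1 x + F2 x).
Proof.
move=> [H1 [h1 d1]] [H2 [h2 d2]]; exists (fun x => H1 x + H2 x).
split=> [|x]; first exact: bounded_polyD.
by rewrite opprD addrACA rpredD.
Qed.

Lemma cong_polyN G d W T F :
  cong_poly G d W T F -> cong_poly G d W T (fun x => - F x).
Proof.
move=> [H [h dH]]; exists (fun x => - H x); split=> [|x]; first exact: bounded_polyN.
by rewrite -opprD rpredN.
Qed.

Lemma cong_poly0 G d W T : cong_poly G d W T (fun=> 0).
Proof.
exists (fun=> 0); split=> [|x]; first exact: bounded_poly0.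
by rewrite subrr dvdz0.
Qed.

Lemma cong_poly_sum n G d W T (F : nat -> X -> int) :
  (forall i, (i < n)%N -> cong_poly G d W T (F i)) ->
  cong_poly G d (n * W) T (fun x => \sum_(i < n) F i x).
Proof.
elim: n => [|n IH] h.
  by apply: cong_poly_weaken (cong_poly0 G d 0 T) => // x; rewrite big_ord0.
have hn : cong_poly G d (n * W) T (fun x => \sum_(i < n) F i x).
  by apply: IH => i ltin; apply: h; apply: ltnW.
apply: cong_poly_weaken (cong_polyD hn (h n (ltnSn n))) => //.
  by rewrite mulSn addnC.
by move=> x; rewrite big_ord_recr.
Qed.

Lemma int_fermat (p : nat) (z : int) :
  prime p -> ~~ (p%:Z %| z)%Z -> (p%:Z %| 1 - z ^+ p.-1)%Z.
Proof.
move=> pp; rewrite !(dvdz_pcharf (pchar_Fp pp)) intrB rmorphXn /= => z0.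
have := expf_card (z%:~R : 'F_p).
rewrite card_Fp // => zp; rewrite subr_eq0 eq_sym; apply/eqP/(mulfI z0).
by rewrite -exprS (prednK (prime_gt0 pp)) zp mulr1.
Qed.

(* The Beigel-Tarui modulus-amplifying polynomial: the upper half of the
   expansion of [(y + u) ^+ (2k+1) = 1], where [u = z ^+ (p-1)] and
   [y = 1 - u]; whichever of [y], [u] is divisible by [p] occurs in the
   relevant half with exponent at least [k+1]. *)
Lemma amplify_dvd (p k : nat) (z : int) : prime p ->
  (p%:Z ^+ k.+1 %| (p%:Z %| z)%Z%:R
     - \sum_(i < k.*2.+2 | (k < i)%N)
         ((1 - z ^+ p.-1) ^+ i * (z ^+ p.-1) ^+ (k.*2.+1 - i)) *+ 'C(k.*2.+1, i))%Z.
Proof.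
move=> pp; set u := z ^+ p.-1; set y := 1 - u.
have p1 : (0 < p.-1)%N by have := prime_gt1 pp; lia.
have binom : \sum_(i < k.*2.+2) (y ^+ i * u ^+ (k.*2.+1 - i)) *+ 'C(k.*2.+1, i) = 1 :> int.
  have := exprDn u y k.*2.+1; rewrite /y [u + _]addrC subrK expr1n => e.
  rewrite [RHS]e.
  by apply: eq_bigr => i _; rewrite mulrC.
have [pz|pz] := boolP (p%:Z %| z)%Z.
  rewrite mulr1n -[X in X - _]binom (bigID (fun i : 'I_ _ => (k < i)%N)) /= [X in X - _]addrC addrK.
  apply: rpred_sum => i ki; rewrite rpredMn //; apply: dvdz_mull.
  apply: dvdz_trans (dvdz_exp2r _ (dvdz_exp p1 pz)).
  by apply: dvdz_exp2l; have := ltn_ord i; lia.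
rewrite mulr0n sub0r rpredN; apply: rpred_sum => i ki; rewrite rpredMn //.
apply: dvdz_mulr.
apply: dvdz_trans (dvdz_exp2r _ (int_fermat pp pz)).
exact: dvdz_exp2l.
Qed.

(** The power [Z ^ p.-1] has weight [w ^ p.-1], and one minus it has weight at most one more. The
    weights in the upper half of the binomial expansion add up to at most those of the whole, a
    power of the sum of the two weights. *)
Lemma amplify G (p k w T : nat) Z : prime p -> bounded_poly G w T Z ->
  cong_poly G (p%:Z ^+ k.+1) ((1 + 2 * w ^ p.-1) ^ k.*2.+1) (T * p.-1 * k.*2.+1)
    (fun x => (modular_fn p Z x)%:R).
Proof.
move=> pp hZ.
exists (fun x => \sum_(i < k.*2.+2 | (k < i)%N)
  ((1 - Z x ^+ p.-1) ^+ i * (Z x ^+ p.-1) ^+ (k.*2.+1 - i)) *+ 'C(k.*2.+1, i)).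
split=> [|x]; last by rewrite ffunE; apply: amplify_dvd.
have hu := bounded_polyX p.-1 hZ.
have hy := bounded_polyB (bounded_poly1 G (T * p.-1)) hu.
have hs : forall i : 'I_k.*2.+2, (k < i)%N ->
  bounded_poly G ('C(k.*2.+1, i) * ((1 + w ^ p.-1) ^ i * (w ^ p.-1) ^ (k.*2.+1 - i)))
   (T * p.-1 * k.*2.+1)
   (fun x => ((1 - Z x ^+ p.-1) ^+ i * (Z x ^+ p.-1) ^+ (k.*2.+1 - i)) *+ 'C(k.*2.+1, i)).
  move=> i ki; apply: bounded_polyMn.
  have := bounded_polyM (bounded_polyX i hy) (bounded_polyX (k.*2.+1 - i) hu).
  apply: bounded_poly_weaken => //.
  by rewrite -mulnDr subnKC // -ltnS.
have := bounded_poly_sum (index_enum _) hs.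
apply: bounded_poly_weaken => //.
set v := (w ^ p.-1)%N; have -> : (1 + 2 * v = v + (1 + v))%N by lia.
rewrite expnDn.
apply: (@leq_trans (\sum_(i < k.*2.+2) 'C(k.*2.+1, i) * ((1 + v) ^ i * v ^ (k.*2.+1 - i)))).
  by rewrite [X in (_ <= X)%N](bigID (fun i : 'I_ _ => (k < i)%N)) /= leq_addr.
by apply: leq_sum => i _; rewrite [(_ ^ i * _)%N]mulnC.
Qed.

Lemma cong_poly_monomialM G d W T T0 t F :
  (size t <= T0)%N -> (forall g, g \in t -> G g) ->
  cong_poly G d W T F -> cong_poly G d W (T0 + T) (fun x => monomial t x * F x).
Proof.
move=> st tG [H [hH dH]]; exists (fun x => monomial t x * H x); split=> [|x].
  by rewrite -[W]mul1n; apply: bounded_polyM => //; apply: bounded_poly_monomial.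
by rewrite -mulrBr dvdz_mull.
Qed.

(* If [p] does not divide [z0] then exactly one [a < p] makes [z + a z0]
   divisible by [p], otherwise all or none do: this trades the product of two
   congruence tests for single tests. *)
Lemma modular_mul (p : nat) (z z0 : int) : prime p ->
  p%:R * ((p%:Z %| z)%Z%:R * (p%:Z %| z0)%Z%:R) =
  \sum_(a < p) (p%:Z %| z + a%:Z * z0)%Z%:R + (p%:Z %| z0)%Z%:R - 1 :> int.
Proof.
move=> pp; have [pz0|pz0] := boolP (p%:Z %| z0)%Z.
  rewrite mulr1n mulr1 addrK.
  rewrite (eq_bigr (fun=> (p%:Z %| z)%Z%:R)) => [|a _].
    by rewrite sumr_const card_ord mulr_natl.
  by rewrite rpredDr // dvdz_mull.
rewrite mulr0n !mulr0 addr0.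
pose u : 'F_p := - z%:~R / z0%:~R.
have ltu : (u < p)%N by rewrite -[X in (_ < X)%N](Fp_cast pp).
have pz0' : z0%:~R != 0 :> 'F_p by rewrite -(dvdz_pcharf (pchar_Fp pp)).
rewrite (bigD1 (Ordinal ltu)) //= big1 ?addr0 => [|a au].
  suff -> : (p%:Z %| z + (u : nat)%:Z * z0)%Z by [].
  rewrite (dvdz_pcharf (pchar_Fp pp)) intrD intrM /= -[(u : nat)%:~R]/((u : nat)%:R).
  by rewrite natr_Zp /u divfK // subrr.
case: (boolP (p%:Z %| _)%Z) => // pa.
case/eqP: au; apply: val_inj => /=.
have : a%:R = u :> 'F_p.
  apply: (mulIf pz0'); rewrite /u divfK //.
  move: pa; rewrite (dvdz_pcharf (pchar_Fp pp)) intrD intrM /= addrC addr_eq0.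
  by move/eqP.
by move/(congr1 val) => /=; rewrite val_Fp_nat // modn_small.
Qed.

Lemma leq_expn2r e m n : (m <= n)%N -> (m ^ e <= n ^ e)%N.
Proof. by case: e => // e; rewrite leq_exp2r. Qed.

(** Induction on the factors still to be absorbed: [r] collects those already in [G'], and the tests
    are merged into the single test of [Z]. By [modular_mul] a merge costs a factor [p] and yields
    [p + 2] terms, while the weight of [Z] grows only additively. The amplification takes place
    once, when [t] is empty, so its degree is not paid anew for each factor. *)
Lemma eliminate_and (G G' : fn -> Prop) (p k w td T wm : nat) :
  prime p ->
  (forall g, G g -> G' g \/
     exists Z, bounded_poly G' w td Z /\ g = modular_fn p Z) ->
  forall t r wz Z,
    (forall g, g \in t -> G g) -> (forall g, g \in r -> G' g) ->
    bounded_poly G' wz td Z -> (size r + size t <= T)%N ->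
    (wz + p * w * size t <= wm)%N ->
  cong_poly G' (p%:Z ^+ k.+1)
    ((p + 2) ^ size t * (1 + 2 * wm ^ p.-1) ^ k.*2.+1) (T + td * p.-1 * k.*2.+1)
    (fun x => p%:R ^+ size t *
       (monomial r x * (modular_fn p Z x)%:R * monomial t x)).
Proof.
move=> pp GG'; elim=> [|g t IH] r wz Z tG rG' hZ szT szw.
  apply: (@cong_poly_weaken _ _ _ _ _ _ (fun x => monomial r x * (modular_fn p Z x)%:R)).
  - exact: leqnn.
  - exact: leqnn.
  - by move=> x; rewrite expr0 mul1r mulr1.
  apply: cong_poly_monomialM => //; first by rewrite addn0 in szT.
  apply: cong_poly_weaken (amplify k pp hZ) => //.
  rewrite mul1n; apply: leq_expn2r; rewrite leq_add2l leq_mul2l /=.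
  by apply: leq_expn2r; apply: leq_trans szw; apply: leq_addr.
have tG' : forall h, h \in t -> G h by move=> h ht; apply: tG; rewrite inE ht orbT.
set W := ((p + 2) ^ size t * (1 + 2 * wm ^ p.-1) ^ k.*2.+1)%N in IH *.
have -> : ((p + 2) ^ size (g :: t) * (1 + 2 * wm ^ p.-1) ^ k.*2.+1 = p * W + W + W)%N.
  by rewrite /W /= expnS; ring.
rewrite /= in szT szw *.
have [gG'|[Z0 [hZ0 eg]]] := GG' g (tG g (mem_head _ _)).
  have h : cong_poly G' (p%:Z ^+ k.+1) W (T + td * p.-1 * k.*2.+1)
     (fun x => p%:R ^+ size t *
       (monomial (g :: r) x * (modular_fn p Z x)%:R * monomial t x)).
    apply: IH hZ _ _ => //; last by apply: leq_trans szw; rewrite leq_add2l leq_mul2l leqnSn orbT.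
      by move=> h; rewrite inE => /orP[/eqP->|/rG'].
    by rewrite /= addSnnS.
  (* The scaling [p] is due for this factor too; it is paid by [p] equal copies. *)
  apply: cong_poly_weaken (cong_poly_sum (n := p) (fun i _ => h)) => //.
    by rewrite -addnA leq_addr.
  move=> x; rewrite sumr_const card_ord -mulr_natl !monomial_cons exprS; ring.
have hS a : (a < p)%N -> cong_poly G' (p%:Z ^+ k.+1) W (T + td * p.-1 * k.*2.+1)
    (fun x => p%:R ^+ size t * (monomial r x *
       (modular_fn p (fun x => Z x + a%:Z * Z0 x) x)%:R * monomial t x)).
  move=> ltap; apply: (IH _ (wz + a * w)%N) => //.
  - apply: (bounded_poly_weaken (G := G') _ _ _ _ (bounded_polyD hZ (bounded_polyMn a hZ0))) => // x.
    by rewrite -mulr_natl natz.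
  - by apply: leq_trans szT; rewrite leq_add2l.
  - apply: leq_trans szw; rewrite -addnA leq_add2l mulnS leq_add2r.
    by rewrite leq_mul2r ltnW ?orbT.
have h0 : cong_poly G' (p%:Z ^+ k.+1) W (T + td * p.-1 * k.*2.+1)
    (fun x => p%:R ^+ size t * (monomial r x *
       (modular_fn p Z0 x)%:R * monomial t x)).
  apply: (IH _ w) => //; first by apply: leq_trans szT; rewrite leq_add2l.
  apply: leq_trans szw; rewrite mulnS addnA leq_add2r.
  apply: leq_trans (leq_addl _ _); apply: leq_pmull; exact: prime_gt0.
(* The constant [1] of [modular_mul] is read as the test of the zero polynomial, so that the
   induction hypothesis covers it. *)
have h1 : cong_poly G' (p%:Z ^+ k.+1) W (T + td * p.-1 * k.*2.+1)
    (fun x => p%:R ^+ size t * (monomial r x *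
       (modular_fn p (fun=> 0) x)%:R * monomial t x)).
  apply: (IH _ 0%N) => //; first exact: bounded_poly0.
    by apply: leq_trans szT; rewrite leq_add2l.
  by apply: leq_trans szw; rewrite add0n mulnS addnA leq_addl.
apply: cong_poly_weaken (cong_polyD (cong_polyD (cong_poly_sum hS) h0) (cong_polyN h1)) => // x.
rewrite monomial_cons eg !ffunE dvdz0 mulr1n -mulr_sumr -mulr_suml -mulr_sumr.
under eq_bigr do rewrite ffunE.
have := modular_mul (Z x) (Z0 x) pp.
set s := \sum_(_ < _) _ => e.
transitivity (p%:R ^+ size t * monomial r x * monomial t x *
  (s + (p%:Z %| Z0 x)%Z%:R - 1)); first ring.
rewrite -e exprS; ring.
Qed.
End BoundedPolynomials.

(** * Eliminating the tests modulo a prime *)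

Section SymmetricPolynomials.
Set Implicit Arguments.
Unset Strict Implicit.
Variable X : finType.
Local Notation fn := {ffun X -> bool}.
Implicit Types (F H Z : X -> int) (G L : fn -> Prop) (t : seq fn).

(** [phi] anticipates the symmetric output gate: it is arbitrary, so [F] may be exchanged for any
    polynomial that determines its value. *)
Definition sym_poly G (W T : nat) (f : fn) : Prop :=
  exists F (phi : int -> bool), bounded_poly G W T F /\ forall x, f x = phi (F x).

Lemma sym_poly_weaken G G' W W' T T' f :
  (forall g, G g -> G' g) -> (W <= W')%N -> (T <= T')%N ->
  sym_poly G W T f -> sym_poly G' W' T' f.
Proof.
move=> GG' WW' TT' [F [phi [hF e]]]; exists F, phi; split=> //.
exact: bounded_poly_weaken hF.
Qed.

(* [F] is recovered from its residue since [|F| <= W]. *)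
Lemma sym_poly_cong G G' (p k W W' T T' : nat) F (phi : int -> bool) (f : fn) :
  prime p -> bounded_poly G W T F -> (forall x, f x = phi (F x)) ->
  (2 * p ^ T * W < p ^ k)%N ->
  cong_poly G' (p%:Z ^+ k) W' T' (fun x => p%:R ^+ T * F x) ->
  sym_poly G' W' T' f.
Proof.
move=> pp hF ef ltW [H [hH dH]].
pose range := [seq i%:Z - W%:Z | i <- iota 0 (2 * W).+1].
exists H, (fun h => has (fun y => (p%:Z ^+ k %| p%:Z ^+ T * y - h)%Z && phi y) range).
split=> // x; rewrite ef; have := bounded_poly_norm x hF.
set y := F x => yW; apply/idP/hasP => [py|[z zr /andP[dz pz]]].
  exists y; last by have := dH x; rewrite natz -/y py andbT.
  apply/mapP; exists (absz (y + W%:Z)); last by lia.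
  by rewrite mem_iota /=; lia.
have zW : `|z| <= W%:R by case/mapP: zr => i; rewrite mem_iota => hi ->; lia.
suff -> : y = z by [].
have : (p%:Z ^+ k %| p%:Z ^+ T * (z - y))%Z.
  have := rpredB dz (dH x); rewrite natz -/y; congr (_ %| _)%Z; ring.
rewrite dvdzE abszM !abszX /= => /dvdn_leq le; apply/eqP; apply/negPn/negP => yz.
have pT : (0 < p ^ T)%N by rewrite expn_gt0 prime_gt0.
have : (0 < p ^ T * absz (z - y)%R)%N by rewrite muln_gt0 pT; lia.
move/le; apply/negP; rewrite -ltnNge; apply: leq_ltn_trans ltW.
have zyW : (absz (z - y)%R <= 2 * W)%N by lia.
by rewrite mulnAC [X in (_ <= X)%N]mulnC leq_mul2l zyW orbT.
Qed.

Lemma eliminate_prime G G' (p k w td W T : nat) f :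
  prime p ->
  (forall g, G g -> G' g \/
     exists Z, bounded_poly G' w td Z /\ g = modular_fn p Z) ->
  (2 * p ^ T * W < p ^ k.+1)%N ->
  sym_poly G W T f ->
  sym_poly G' (W * ((p + 2) ^ T * (1 + 2 * (p * w * T) ^ p.-1) ^ k.*2.+1))
    (T + td * p.-1 * k.*2.+1) f.
Proof.
move=> pp GG' ltW [F [phi [hF ef]]].
apply: (sym_poly_cong pp hF ef ltW).
apply: (bounded_poly_linear (G := G) (T := T)
  (P := fun n H => cong_poly G' (p%:Z ^+ k.+1) n (T + td * p.-1 * k.*2.+1) H)) => //.
- by move=> n n' F1 F2 le e; apply: cong_poly_weaken.
- exact: cong_poly0.
- by move=> n n' F1 F2; apply: cong_polyD.
- by move=> n F1; apply: cong_polyN.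
move=> t st tG.
(* The absorption starts from the zero polynomial, whose test always holds. *)
have h := @eliminate_and X G G' p k w td T (p * w * T) pp GG' t [::] 0 (fun=> 0) tG.
have {h} : cong_poly G' (p%:Z ^+ k.+1)
    ((p + 2) ^ size t * (1 + 2 * (p * w * T) ^ p.-1) ^ k.*2.+1) (T + td * p.-1 * k.*2.+1)
    (fun x => p%:R ^+ size t * monomial t x).
  apply: cong_poly_weaken (h _ _ _ _) => //.
  - by move=> x; rewrite ffunE dvdz0 mulr1 mul1r.
  - exact: bounded_poly0.
  - by rewrite add0n leq_mul2l st orbT.
move=> h.
(* Shorter monomials carry a smaller power of [p]; repetition brings all of them to the common
   factor [p ^ T]. *)
apply: cong_poly_weaken (cong_poly_sum (n := p ^ (T - size t)) (fun i _ => h)) => //.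
  rewrite mulnA; apply: leq_mul => //.
  apply: (@leq_trans ((p + 2) ^ (T - size t) * (p + 2) ^ size t)).
    by rewrite leq_mul // leq_expn2r // leq_addr.
  by rewrite -expnD subnK.
move=> x; rewrite sumr_const card_ord -[LHS]mulr_natl natrX mulrA -exprD subnK //.
Qed.

(** One number [B] measures both the degree and the logarithm of the weight. The amplified power has
    exponent [O(B)] and a base whose logarithm is linear in [K] for fixed [m], so [B] is multiplied
    by [K] and a constant depending on [m]. *)
Lemma eliminate_prime_log G G' (m p K B w td : nat) f :
  prime p -> (p <= m)%N -> (0 < K)%N -> (0 < B)%N -> (B <= 2 ^ K)%N ->
  (w <= 2 ^ K)%N -> (td <= m)%N ->
  (forall g, G g -> G' g \/
     exists Z, bounded_poly G' w td Z /\ g = modular_fn p Z) ->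
  sym_poly G (2 ^ B) B f ->
  sym_poly G' (2 ^ (20 * m.+1 ^ 2 * K * B)) (20 * m.+1 ^ 2 * K * B) f.
Proof.
move=> pp pm K0 B0 BK wK tdm GG' hf.
have p1 := prime_gt1 pp.
(* The order of amplification, [2 * B + 1], leaves room for the scaling [p ^ B] and for values of
   [F] up to [2 ^ B] in absolute value. *)
have ltW : (2 * p ^ B * 2 ^ B < p ^ (2 * B + 1).+1)%N.
  have -> : ((2 * B + 1).+1 = B + (B + 2))%N by lia.
  rewrite expnD [X in (X < _)%N](_ : _ = p ^ B * 2 ^ B.+1)%N; last by rewrite expnS; ring.
  rewrite ltn_pmul2l; last by rewrite expn_gt0; lia.
  apply: (@leq_trans (2 ^ (B + 2))); first by rewrite ltn_exp2l //; lia.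
  exact: leq_expn2r.
have := eliminate_prime pp GG' ltW hf.
apply: sym_poly_weaken => //; last first.
  apply: (@leq_trans (B + m * m * (8 * B))).
    by rewrite leq_add2l leq_mul //; [rewrite leq_mul //; lia | lia].
  nia.
have leT : (p * w * B <= 2 ^ (m + 2 * K))%N.
  apply: (@leq_trans (2 ^ m * 2 ^ K * 2 ^ K)); last by rewrite -!expnD; apply: leq_pexp2l => //; lia.
  by rewrite !leq_mul //; apply: leq_trans pm _; apply/ltnW/ltn_expl.
have leX : (1 + 2 * (p * w * B) ^ p.-1 <= 2 ^ (2 + (m + 2 * K) * m))%N.
  have : ((p * w * B) ^ p.-1 <= 2 ^ ((m + 2 * K) * m))%N.
    rewrite expnM; apply: (@leq_trans ((2 ^ (m + 2 * K)) ^ p.-1)); first exact: leq_expn2r.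
    by apply: leq_pexp2l; [rewrite expn_gt0 | lia].
  have : (0 < 2 ^ ((m + 2 * K) * m))%N by rewrite expn_gt0.
  rewrite expnD; lia.
have lep : ((p + 2) ^ B <= 2 ^ ((m + 2) * B))%N.
  rewrite expnM; apply: leq_expn2r; apply: (@leq_trans (m + 2)); first by lia.
  exact/ltnW/ltn_expl.
apply: (@leq_trans (2 ^ B * (2 ^ ((m + 2) * B) * (2 ^ (2 + (m + 2 * K) * m)) ^ (8 * B)))).
  apply: leq_mul => //; apply: leq_mul => //.
  apply: leq_trans (leq_expn2r _ leX) _; apply: leq_pexp2l; first by rewrite expn_gt0.
  by lia.
rewrite -expnM -!expnD; apply: leq_pexp2l => //.
have : (1 + (m + 2) + 8 * (2 + (m + 2 * K) * m) <= 20 * m.+1 ^ 2 * K)%N by nia.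
move=> /(leq_mul (leqnn B)); nia.
Qed.

Definition modular_over L (w td : nat) (ps : seq nat) (g : fn) : Prop :=
  L g \/ exists p Z, [/\ p \in ps, bounded_poly L w td Z & g = modular_fn p Z].

(** While the tests modulo one prime are eliminated, those modulo the remaining primes count as
    atoms. The size hypothesis on the final bound covers all intermediate ones. *)
Lemma eliminate_primes L (m K w td : nat) (ps : seq nat) f B :
  all prime ps -> all (fun p => p <= m)%N ps -> (0 < K)%N -> (0 < B)%N ->
  ((20 * m.+1 ^ 2 * K) ^ size ps * B <= 2 ^ K)%N ->
  (w <= 2 ^ K)%N -> (td <= m)%N ->
  sym_poly (modular_over L w td ps) (2 ^ B) B f ->
  sym_poly L (2 ^ ((20 * m.+1 ^ 2 * K) ^ size ps * B))
    ((20 * m.+1 ^ 2 * K) ^ size ps * B) f.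
Proof.
move=> pps psm K0 B0 leB wK tdm; set c := (20 * m.+1 ^ 2 * K)%N in leB *.
have c0 : (0 < c)%N by rewrite /c !muln_gt0 K0.
elim: ps B B0 pps psm leB => [|p ps IH] B B0 /= pps psm leB hf.
  rewrite expn0 mul1n; apply: sym_poly_weaken hf => // g [//|[p [Z []]]] //.
case/andP: pps => pp pps; case/andP: psm => pm psm.
rewrite expnSr -mulnA; apply: IH => //.
- by rewrite muln_gt0 c0.
- by rewrite mulnA -expnSr.
apply: (eliminate_prime_log pp pm K0 B0 _ wK tdm _ hf).
  apply: leq_trans leB; by apply: leq_pmull; rewrite expn_gt0 c0.
move=> g [hL|[q [Z [qps hZ e]]]]; first by left; left.
move: qps; rewrite inE => /orP[/eqP qp|qps]; last by left; right; exists q, Z.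
right; exists Z; rewrite -qp; split=> //.
by apply: bounded_poly_weaken hZ => // h hh; left.
Qed.

(** An atom of [L'] opens into at most two monomials of degree at most [t2], so a product of [B]
    atoms opens into at most [2 ^ B] monomials of degree at most [t2 * B]. The factor [2 * t2] pays
    for this before the primes are eliminated. *)
Lemma eliminate_level L L' (m K w td t2 : nat) (ps : seq nat) f B :
  all prime ps -> all (fun p => p <= m)%N ps -> (0 < K)%N -> (0 < B)%N ->
  (0 < t2)%N ->
  ((20 * m.+1 ^ 2 * K) ^ size ps * (2 * t2 * B) <= 2 ^ K)%N ->
  (w <= 2 ^ K)%N -> (td <= m)%N ->
  (forall g, L' g -> bounded_poly (modular_over L w td ps) 2 t2 (fun x => (g x)%:R)) ->
  sym_poly L' (2 ^ B) B f ->
  sym_poly L (2 ^ ((20 * m.+1 ^ 2 * K) ^ size ps * (2 * t2 * B)))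
    ((20 * m.+1 ^ 2 * K) ^ size ps * (2 * t2 * B)) f.
Proof.
move=> pps psm K0 B0 t0 leB wK tdm LL' [F [phi [hF ef]]].
apply: (eliminate_primes (w := w) (td := td)) => //.
  by rewrite !muln_gt0 t0 B0.
exists F, phi; split=> //.
have hm t : (forall g, g \in t -> L' g) ->
    bounded_poly (modular_over L w td ps) (2 ^ size t) (t2 * size t) (monomial t).
  elim: t => [|g t IH] tL; first by rewrite muln0; apply: bounded_poly1.
  rewrite /= expnS mulnS.
  apply: bounded_poly_weaken (bounded_polyM (LL' g (tL g (mem_head _ _))) (IH _)) => //.
    by move=> x; rewrite monomial_cons.
  by move=> h ht; apply: tL; rewrite inE ht orbT.
have := @bounded_poly_subst X L' (modular_over L w td ps) (2 ^ B) B (2 ^ B) (t2 * B) F.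
case/(_ _ hF)=> [t st tL|].
  apply: bounded_poly_weaken (hm t tL) => //; first exact: leq_pexp2l.
  by rewrite leq_mul2l st orbT.
move=> s hs; apply: (@bounded_poly_weaken X _ _ _ _ _ _ F F _ _ _ _ (ex_intro _ s hs)) => //.
  by rewrite -expnD; apply: leq_pexp2l => //; nia.
nia.
Qed.
End SymmetricPolynomials.

(** * Lucas' theorem and derandomization *)

Lemma coef_binomial (R : comNzRingType) (q n k : nat) : (0 < q)%N ->
  (('X^q + 1 : {poly R}) ^+ n)`_(q * k) = 'C(n, k)%:R.
Proof.
move=> q0; rewrite exprD1n coef_sum.
transitivity (\sum_(i < n.+1) (if i == k :> nat then 'C(n, k)%:R else 0 : R)).
  apply: eq_bigr => i _; rewrite coefMn -exprM coefXn eqn_pmul2l // eq_sym.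
  by case: eqP => [->|]; rewrite ?mul0rn.
rewrite -big_mkcond; case: (ltnP k n.+1) => [kn|nk].
  by rewrite (big_pred1 (Ordinal kn)).
by rewrite big1 ?bin_small // => i /eqP ik; have := ltn_ord i; rewrite ik ltnNge nk.
Qed.

(** Over ['F_p] the Frobenius map turns [(X + 1) ^ (q * M)] into [(X ^ q + 1) ^ M], where
    [q = p ^ j]; compare the coefficients of [X ^ q]. *)
Lemma bin_pexp_mod (p j M : nat) : prime p ->
  'C(p ^ j * M, p ^ j)%:R = M%:R :> 'F_p.
Proof.
move=> pp; set q := (p ^ j)%N.
have q0 : (0 < q)%N by rewrite expn_gt0 prime_gt0.
have pq : [pchar {poly 'F_p}].-nat q.
  by rewrite /q pnatX pnatE // (rmorph_pchar polyC (pchar_Fp pp)).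
have e : ('X^1 + 1) ^+ (q * M) = ('X^q + 1) ^+ M :> {poly 'F_p}.
  by rewrite exprM exprDn_pchar // expr1n.
have := @coef_binomial 'F_p 1 (q * M) q isT; rewrite mul1n => <-.
by rewrite e -[q in _`_q]muln1 coef_binomial // bin1.
Qed.

(** Write [N = p ^ j * M]: the binomial coefficient is congruent to [M] modulo [p]. *)
Lemma dvdn_pexpS (p j N : nat) : prime p -> (p ^ j %| N)%N ->
  (p ^ j.+1 %| N)%N = (p %| 'C(N, p ^ j))%N.
Proof.
move=> pp /dvdnP[M ->]; rewrite mulnC expnSr dvdn_pmul2l ?expn_gt0 ?prime_gt0 //.
by rewrite !(dvdn_pcharf (pchar_Fp pp)) bin_pexp_mod.
Qed.

Lemma dvdn_pexp_bin (p e N : nat) : prime p ->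
  (p ^ e %| N)%N = all (fun j => p %| 'C(N, p ^ j))%N (iota 0 e).
Proof.
move=> pp; elim: e => [|e IH]; first by rewrite expn0 dvd1n.
rewrite -addn1 iotaD all_cat -IH /= add0n andbT addn1.
case: (boolP (p ^ e %| N)%N) => [h|h] /=; first exact: dvdn_pexpS.
by apply: contraNF h => /(dvdn_trans _); apply; rewrite expnS dvdn_mull.
Qed.

Lemma dvdn_bin (m N : nat) : (0 < m)%N ->
  (m %| N)%N = all (fun p => all (fun j => p %| 'C(N, p ^ j))%N (iota 0 (logn p m))) (primes m).
Proof.
move=> m0; apply/idP/allP => [mN p|h].
  rewrite mem_primes => /andP[pp _]; rewrite -dvdn_pexp_bin //.
  by apply: dvdn_trans mN; apply: pfactor_dvdnn.
apply/dvdn_partP => // p pm; rewrite p_part.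
have := pm; rewrite mem_primes => /andP[pp _].
by rewrite dvdn_pexp_bin //; apply: h.
Qed.

(** Greedy choice with the potential that sums [4 ^ count] over all points. A random seed multiplies
    it on average by at most [1 + 3/16 = 19/16], so some seed does no worse. A point where at least
    half of the [2 * n.+1] votes are bad would contribute [2 ^ (2 * n.+1)], more than the final
    potential, because [2 * 19 ^ 2 <= 32 ^ 2]. *)
Lemma derandomize (X Om : finType) (bad : Om -> X -> bool) (n : nat) :
  (0 < #|Om|)%N -> (#|X| <= 2 ^ n)%N ->
  (forall x, 16 * #|[pred w | bad w x]| <= #|Om|)%N ->
  exists s : seq Om, size s = (2 * n.+1)%N /\
    forall x, (2 * count (bad^~ x) s < size s)%N.
Proof.
move=> Om0 Xn hbad.
have arith (b o : nat) : (16 * b <= o -> 16 * (o + 3 * b) <= 19 * o)%N by lia.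
have arith2 (c o s : nat) :
  (0 < o -> 16 * s <= 19 * c * o -> o * (19 * c).+1 <= 16 * s -> False)%N by nia.
have greedy l : exists s : seq Om, size s = l /\
    (16 ^ l * (\sum_(x : X) 4 ^ count (bad^~ x) s) <= 19 ^ l * #|X|)%N.
  elim: l => [|l [s [sl IH]]].
    exists [::]; split=> //; rewrite !mul1n /= sum_nat_const expn0 muln1 //.
  pose pot w := (\sum_(x : X) 4 ^ count (bad^~ x) (w :: s))%N.
  pose cur := (\sum_(x : X) 4 ^ count (bad^~ x) s)%N.
  have tot : (16 * (\sum_w pot w) <= 19 * cur * #|Om|)%N.
    rewrite /pot exchange_big big_distrr /= /cur -mulnA big_distrl big_distrr /=.
    apply: leq_sum => x _.
    have -> : (\sum_(w : Om) 4 ^ (bad w x + count (bad^~ x) s) =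
      4 ^ count (bad^~ x) s * (#|Om| + 3 * #|[pred w | bad w x]|))%N.
      rewrite (eq_bigr (fun w => 4 ^ count (bad^~ x) s * (1 + 3 * bad w x)))%N => [|w _].
        rewrite -big_distrr big_split /= sum1_card -big_distrr /=.
        rewrite -[#|[pred w | bad w x]|]sum1_card [in RHS]big_mkcond /=.
        by congr (_ * (_ + _ * _))%N.
      by rewrite expnD mulnC; case: (bad w x).
    rewrite mulnCA [X in (_ <= X)%N]mulnCA leq_mul2l; apply/orP; right.
    exact: arith (hbad x).
  have [w hw] : exists w, (16 * pot w <= 19 * cur)%N.
    apply/existsP; apply: contraLR Om0 => /existsPn h; rewrite -leqNgt leqNgt.
    apply/negP => Om0.
    have : (\sum_(w : Om) (19 * cur).+1 <= \sum_w 16 * pot w)%N.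
      by apply: leq_sum => w _; rewrite ltnNge h.
    by rewrite sum_nat_const -big_distrr /=; exact: arith2 Om0 tot.
  exists (w :: s); split; first by rewrite /= sl.
  rewrite !expnS; have := hw; rewrite -/(pot w) /cur; move: IH.
  set A := (16 ^ l)%N; set B := (19 ^ l)%N; set P := pot w; set Q := (\sum_x _)%N.
  by nia.
have [s [ss hs]] := greedy (2 * n.+1)%N.
exists s; split=> // x; rewrite ltnNge; apply/negP => hx.
have hx4 : (2 ^ (2 * n.+1) <= \sum_(x : X) 4 ^ count (bad^~ x) s)%N.
  rewrite (bigD1 x) //= -ss; apply: leq_trans (leq_addr _ _).
  by rewrite -[4%N]/(2 ^ 2)%N -expnM leq_exp2l.
move: hs; apply/negP; rewrite -ltnNge.
apply: (@leq_trans (16 ^ (2 * n.+1) * 2 ^ (2 * n.+1))); last by rewrite leq_mul2l hx4 orbT.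
apply: (@leq_ltn_trans (19 ^ (2 * n.+1) * 2 ^ n)); first by rewrite leq_mul2l Xn orbT.
rewrite -expnMn !(expnM _ 2).
apply: (@leq_trans ((19 ^ 2) ^ n.+1 * 2 ^ n.+1)).
  by rewrite ltn_pmul2l ?expn_gt0 // ltn_exp2l.
by rewrite -expnMn; apply: leq_expn2r.
Qed.

(** * Approximating gates and layers *)

Section Gates.
Set Implicit Arguments.
Unset Strict Implicit.
Variable X : finType.
Local Notation fn := {ffun X -> bool}.
Implicit Types (L : fn -> Prop) (hs : seq fn) (U A : {set fn}) (v : fn -> bool).

(** The argument [v] is a valuation rather than a point of [X], since gates are tested on
    approximations of their inputs, possibly negated. *)
Definition members hs (A : {set fn}) (v : fn -> bool) : nat :=
  \sum_(h <- hs | h \in A) v h.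

Definition flip (h0 : fn) (A : {set fn}) : {set fn} :=
  if h0 \in A then A :\ h0 else h0 |: A.

Lemma flipK h0 : involutive (flip h0).
Proof.
move=> A; rewrite /flip; case: (boolP (h0 \in A)) => hA.
  by rewrite setD11 setD1K.
by rewrite setU11 setU1K.
Qed.

Lemma members_flip hs A v (h0 : fn) : uniq hs -> h0 \in hs -> v h0 -> h0 \in A ->
  members hs A v = (members hs (flip h0 A) v).+1.
Proof.
move=> uhs h0s vh0 h0A; rewrite /members /flip h0A big_mkcond (bigD1_seq h0) //= h0A vh0 add1n.
rewrite [in RHS]big_mkcond [in RHS](bigD1_seq h0) //= !inE eqxx add0n; congr _.+1.
by apply: eq_bigr => h hh0; rewrite !inE hh0.
Qed.

(** Toggling a true function changes the sum by one, and a prime divides at most one of two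
    consecutive integers. *)
Lemma flip_not_dvd (p : nat) hs A v (h0 : fn) : prime p -> uniq hs -> h0 \in hs -> v h0 ->
  (p %| members hs A v)%N -> ~~ (p %| members hs (flip h0 A) v)%N.
Proof.
move=> pp uhs h0s vh0; have [hA|hA] := boolP (h0 \in A).
  rewrite (members_flip uhs h0s vh0 hA) => hp; apply: contraL pp => hp'.
  have : (p %| 1)%N by rewrite -(dvdn_addr 1 hp') addn1.
  by rewrite dvdn1 => /eqP ->.
have hA' : h0 \in flip h0 A by rewrite /flip (negbTE hA) setU11.
move=> hp; rewrite (members_flip uhs h0s vh0 hA') flipK; apply: contraL pp => hp'.
have : (p %| 1)%N by rewrite -(dvdn_addr 1 hp) addn1.
by rewrite dvdn1 => /eqP ->.
Qed.

(** The sets range over all functions and are not tied to a gate, so one seed serves all gates at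
    once. *)
Definition seed tau := {ffun 'I_tau -> {set fn}}.

Definition test (p tau : nat) hs (w : seed tau) (v : fn -> bool) : bool :=
  [forall k, p %| members hs (w k) v]%N.

(* Toggling a fixed true function in any subset of the coordinates turns a
   passing seed into distinct seeds. *)
Lemma test_rare (p tau : nat) hs (v : fn -> bool) : prime p -> uniq hs ->
  has v hs ->
  (#|[set w : seed tau | test p hs w v]| * 2 ^ tau <= #|{: seed tau}|)%N.
Proof.
move=> pp uhs /hasP[h0 h0s vh0].
pose g (u : seed tau * {set 'I_tau}) : seed tau :=
  [ffun k => if k \in u.2 then flip h0 (u.1 k) else u.1 k].
pose Y := setX [set w : seed tau | test p hs w v] [set: {set 'I_tau}].
have gi : {in Y &, injective g}.
  move=> [w S] [w' S']; rewrite !inE !andbT /= => /forallP tw /forallP tw' /ffunP e.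
  have eS : S = S'.
    apply/setP => k; have := e k; rewrite !ffunE /=.
    have := tw k; have := tw' k.
    case: (k \in S) (k \in S') => -[] // h' h ek.
      by have := flip_not_dvd pp uhs h0s vh0 h; rewrite ek h'.
    by have := flip_not_dvd pp uhs h0s vh0 h'; rewrite -ek h.
  rewrite -eS in e *; congr pair; apply/ffunP => k; have := e k; rewrite !ffunE /=.
  by case: (k \in S) => //; apply: inv_inj; apply: flipK.
have := max_card (mem (g @: Y)); rewrite card_in_imset // cardsX.
by rewrite -powersetT card_powerset cardsT card_ord.
Qed.

Inductive acc_gate (m : nat) U : fn -> Prop :=
| AccAnd hs of {subset hs <= U} : acc_gate m U [ffun x => all (fun h : fn => h x) hs]
| AccOr hs of {subset hs <= U} : acc_gate m U [ffun x => has (fun h : fn => h x) hs]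
| AccNot h of h \in U : acc_gate m U [ffun x => ~~ h x]
| AccMod hs of {subset hs <= U} :
    acc_gate m U [ffun x => m %| count (fun h : fn => h x) hs]%N.

(** Pascal's rule, splitting on the value of the first function. *)
Lemma bounded_poly_bin L (ks : seq fn) k : (forall g, g \in ks -> L g) ->
  bounded_poly L ((size ks).+1 ^ k) k
    (fun x => ('C(count (fun h : fn => h x) ks, k))%:Z).
Proof.
elim: ks k => [|h ks IH] [|k] hL /=.
- by apply: bounded_poly_weaken (bounded_poly1 L 0).
- by apply: bounded_poly_weaken (bounded_poly0 L 0 0) => // x.
- apply: bounded_poly_weaken (bounded_poly1 L 0) => // x.
  by rewrite bin0.
have {}IH j : bounded_poly L ((size ks).+1 ^ j) j
    (fun x => ('C(count (fun h : fn => h x) ks, j))%:Z).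
  by apply: IH => g gks; apply: hL; rewrite inE gks orbT.
have hh : bounded_poly L 1 1 (fun x => (h x)%:R).
  by apply: bounded_poly_atom => //; apply: hL; rewrite mem_head.
apply: bounded_poly_weaken (bounded_polyD (IH k.+1) (bounded_polyM hh (IH k))) => //.
  rewrite mul1n [X in (_ <= X)%N]expnS mulSn addnC expnS leq_add //.
    by rewrite leq_expn2r.
  by rewrite leq_mul // leq_expn2r.
move=> x; case: (h x); last by rewrite mul0r addr0.
by rewrite mul1r add1n binS PoszD.
Qed.

(* Only multiplicities modulo [m] matter. *)
Lemma mod_reduce (m : nat) U hs : (0 < m)%N -> {subset hs <= U} ->
  exists hs', [/\ {subset hs' <= U}, (size hs' <= m * #|U|)%N &
    forall v : fn -> bool, count v hs = count v hs' %[mod m]].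
Proof.
move=> m0 hsU.
exists (flatten [seq nseq (count_mem h hs %% m) h | h <- enum U]); split.
- move=> g /flattenP[s /mapP[h hU ->]]; rewrite mem_nseq => /andP[_ /eqP ->].
  by rewrite mem_enum in hU.
- rewrite size_flatten /shape -map_comp sumnE big_map big_enum /=.
  rewrite mulnC -sum_nat_const; apply: leq_sum => h _.
  by rewrite size_nseq ltnW // ltn_mod.
move=> v; rewrite count_flatten -map_comp sumnE big_map big_enum /=.
have -> : count v hs = (\sum_(h in U) count_mem h hs * v h)%N.
  elim: hs hsU => [|g hs IH] hsU; first by rewrite big1.
  have gU : g \in U by apply: hsU; rewrite mem_head.
  rewrite /= IH; last by move=> h hh; apply: hsU; rewrite inE hh orbT.
  rewrite [RHS](eq_bigr (fun h => (g == h) * v h + count_mem h hs * v h))%N; last first.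
    by move=> h _; rewrite mulnDl.
  rewrite big_split /=; congr addn.
  rewrite (bigD1 g) //= eqxx mul1n big1 ?addn0 // => h /andP[_ hg].
  by rewrite eq_sym (negbTE hg).
rewrite -(modn_summ (index_enum _)) -[RHS](modn_summ (index_enum _)).
congr (_ %% _)%N; apply: eq_bigr => h _; rewrite count_nseq [(v h * _)%N]mulnC.
by rewrite modnMml.
Qed.

(** By [dvdn_bin] the gate is exactly one monomial, a product of tests on binomial coefficients,
    with one test for each prime factor of [m] counted with multiplicity. Each [p ^ j] that occurs
    is at most [m], which bounds the degree under the tests. *)
Lemma mod_gate L (m M : nat) (ks : seq fn) : (1 < m)%N ->
  (forall g, g \in ks -> L g) -> (size ks <= m * M)%N ->
  bounded_poly (modular_over L ((m * M).+1 ^ m) m (primes m)) 1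
    (\sum_(p <- primes m) logn p m) (fun x => (m %| count (fun h : fn => h x) ks)%N%:R).
Proof.
move=> m1 ksL szk.
pose Z p j x := ('C(count (fun h : fn => h x) ks, p ^ j))%:Z.
pose t := [seq modular_fn p (Z p j) | p <- primes m, j <- iota 0 (logn p m)].
have e x : monomial t x = (m %| count (fun h : fn => h x) ks)%N%:R.
  rewrite /monomial dvdn_bin ?(ltnW m1) //; congr (nat_of_bool _)%:R.
  apply/all_allpairsP/allP => h p => [pm|j pm jm].
    by apply/allP => j jm; have := h p j pm jm; rewrite ffunE.
  by rewrite ffunE; move/allP: (h p pm); apply.
set G := modular_over _ _ _ _; set T := (\sum_(p <- _) _)%N.
apply: (@bounded_poly_weaken _ G G 1 1 T T (monomial t)) => //.
apply: bounded_poly_monomial.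
  rewrite size_allpairs_dep sumnE big_map; apply: leq_sum => p _.
  by rewrite size_iota.
move=> g /allpairsPdep[p [j [pm]]]; rewrite mem_iota /= add0n => jl ->.
have pj : (p ^ j <= m)%N.
  by apply: dvdn_leq; [exact: ltnW | rewrite pfactor_dvdn ?(ltnW jl) ?(ltnW m1) //;
    move: pm; rewrite mem_primes => /andP[]].
right; exists p, (Z p j); split=> //.
apply: bounded_poly_weaken (bounded_poly_bin (p ^ j) ksL) => //.
apply: (@leq_trans ((m * M).+1 ^ (p ^ j))); first exact: leq_expn2r.
exact: leq_pexp2l.
Qed.
End Gates.

(** * Random approximation of gates and of whole layers *)

Section Layers.
Set Implicit Arguments.
Unset Strict Implicit.
Variable X : finType.
Local Notation fn := {ffun X -> bool}.
Implicit Types (L : fn -> Prop) (hs : seq fn) (U V A : {set fn}).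

Lemma bounded_poly_members L hs A c (v : X -> fn -> bool) :
  (forall h, h \in hs -> bounded_poly L c 1 (fun x => (v x h)%:R)) ->
  bounded_poly L (c * size hs) 1 (fun x => (members hs A (v x))%:Z).
Proof.
elim: hs => [|h hs IH] hv.
  apply: bounded_poly_weaken (bounded_poly0 L 0 1) => // x.
  by rewrite /members big_nil.
have {}IH : bounded_poly L (c * size hs) 1 (fun x => (members hs A (v x))%:Z).
  by apply: IH => g gh; apply: hv; rewrite inE gh orbT.
case hA : (h \in A); last first.
  apply: bounded_poly_weaken IH => //; first by rewrite leq_mul2l leqnSn orbT.
  by move=> x; rewrite /members big_cons hA.
apply: bounded_poly_weaken (bounded_polyD (hv h (mem_head _ _)) IH) => //.
  by rewrite /= mulnS.
by move=> x; rewrite /members big_cons hA PoszD natz.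
Qed.

Lemma bounded_poly_test L (m w p tau c : nat) hs (s : seed X tau) (v : X -> fn -> bool) :
  p \in primes m -> (0 < m)%N -> (c * size hs <= w)%N ->
  (forall h, h \in hs -> bounded_poly L c 1 (fun x => (v x h)%:R)) ->
  bounded_poly (modular_over L w m (primes m)) 1 tau (fun x => (test p hs s (v x))%:R).
Proof.
move=> pm m0 cw hv.
pose t := [seq modular_fn p (fun x => (members hs (s k) (v x))%:Z) | k <- enum 'I_tau].
set G := modular_over _ _ _ _.
apply: (@bounded_poly_weaken _ G G 1 1 tau tau (monomial t)) => //.
  move=> x; rewrite /monomial; congr (nat_of_bool _)%:R; rewrite all_map.
  apply/allP/forallP => h k; last by move=> _ /=; rewrite ffunE; apply: h.
  by have := h k (mem_enum _ _); rewrite /= ffunE.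
apply: bounded_poly_monomial; first by rewrite size_map size_enum_ord.
move=> g /mapP[k _ ->]; right.
exists p, (fun x => (members hs (s k) (v x))%:Z); split=> //.
exact: bounded_poly_weaken (bounded_poly_members (s k) hv).
Qed.

Definition prime_exponents (m : nat) : nat := \sum_(p <- primes m) logn p m.

(** The error of AND and OR is one-sided: a wrong answer means that some input is false,
    respectively true, while all [tau] sums vanish modulo [p]. NOT and MOD gates are exact on exact
    inputs. Only seeds that are right on all of [U] at [x] are counted, so that the errors of
    separate gates can be added. *)
Lemma gate_approx L (m M tau : nat) U (g : fn) (a : seed X tau -> fn -> fn) :
  (1 < m)%N -> (#|U| <= M)%N -> (forall s h, h \in U -> L (a s h)) ->
  acc_gate m U g ->
  exists b : seed X tau -> fn,
    (forall s, bounded_poly (modular_over L ((m * M).+1 ^ m) m (primes m)) 2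
       (tau + prime_exponents m).+1 (fun x => (b s x)%:R)) /\
    (forall x, #|[set s | (b s x != g x) && [forall (h | h \in U), a s h x == h x]]|
       * 2 ^ tau <= #|{: seed X tau}|)%N.
Proof.
move=> m1 UM La gU.
set w := ((m * M).+1 ^ m)%N; set t2 := (tau + prime_exponents m).+1.
(* AND and OR gates are tested modulo one fixed prime divisor of [m], so that their tests are among
   those available for MOD gates. *)
have [pp pm] : prime (pdiv m) /\ pdiv m \in primes m.
  by rewrite mem_primes pdiv_dvd ltnW // pdiv_prime.
set p := pdiv m in pp pm.
have m0 := ltnW m1.
have size_undup hs : {subset hs <= U} -> (size (undup hs) <= M)%N.
  move=> hsU; apply: leq_trans UM; rewrite cardE; apply: uniq_leq_size.
    exact: undup_uniq.
  by move=> h; rewrite mem_undup mem_enum => /hsU.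
have w2 n : (n <= M)%N -> (2 * n <= w)%N.
  move=> nM; apply: (@leq_trans ((m * M).+1 ^ 1)); first by rewrite expn1; nia.
  exact: leq_pexp2l.
have hL1 s h : h \in U -> bounded_poly L 1 1 (fun x => (a s h x)%:R).
  by move=> hU; apply: bounded_poly_atom => //; apply: La.
have hL2 s h : h \in U -> bounded_poly L 2 1 (fun x => (~~ a s h x)%:R).
  move=> hU.
  apply: bounded_poly_weaken (bounded_polyB (bounded_poly1 L 1) (hL1 s h hU)) => // x.
  by case: (a s h x).
have compl (F : X -> bool) T : (T <= t2)%N ->
    bounded_poly (modular_over L w m (primes m)) 1 T (fun x => (F x)%:R) ->
    bounded_poly (modular_over L w m (primes m)) 2 t2 (fun x => (~~ F x)%:R).
  move=> TT hF; apply: bounded_poly_weaken (bounded_polyB (bounded_poly1 _ T) hF) => // x.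
  by case: (F x).
have exact_case (b : seed X tau -> fn) :
    (forall s x, (forall h, h \in U -> a s h x = h x) -> b s x = g x) ->
    forall x, (#|[set s | (b s x != g x) && [forall (h | h \in U), a s h x == h x]]|
       * 2 ^ tau <= #|{: seed X tau}|)%N.
  move=> hb x; rewrite (_ : [set s | _] = set0) ?cards0 //.
  apply/setP => s; rewrite !inE; apply/negbTE/negP => /andP[/eqP ne /forall_inP h].
  by apply: ne; apply: hb => h' h'U; apply/eqP/h.
have random_case (b : seed X tau -> fn) hs (v : X -> fn -> bool) : {subset hs <= U} ->
    (forall s x, (forall h, h \in U -> a s h x = h x) -> b s x != g x ->
       has (v x) (undup hs) /\ test p (undup hs) s (v x)) ->
    forall x, (#|[set s | (b s x != g x) && [forall (h | h \in U), a s h x == h x]]|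
       * 2 ^ tau <= #|{: seed X tau}|)%N.
  move=> hsU hb x.
  have [hv|hv] := boolP (has (v x) (undup hs)).
    apply: leq_trans (test_rare tau pp (undup_uniq hs) hv).
    rewrite leq_mul2r; apply/orP; right; apply: subset_leq_card.
    apply/subsetP => s; rewrite !inE => /andP[ne /forall_inP h].
    by have [] := hb s x (fun h' h'U => eqP (h h' h'U)) ne.
  rewrite (_ : [set s | _] = set0) ?cards0 //.
  apply/setP => s; rewrite !inE; apply/negbTE/negP => /andP[ne /forall_inP h].
  by have [hv' _] := hb s x (fun h' h'U => eqP (h h' h'U)) ne; rewrite hv' in hv.
have members_eq hs (s : seed X tau) (v v' : fn -> bool) : {subset hs <= U} ->
    (forall h, h \in U -> v h = v' h) ->
    test p (undup hs) s v = test p (undup hs) s v' :> bool.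
  move=> hsU e; apply: eq_forallb => k; congr (_ %| _)%N; rewrite /members big_seq_cond.
  rewrite [RHS]big_seq_cond; apply: eq_bigr => h /andP[hh _].
  by rewrite e //; apply: hsU; rewrite -mem_undup.
have test_none hs (s : seed X tau) (v : fn -> bool) : ~~ has v hs -> test p (undup hs) s v.
  move=> hv; apply/forallP => k; rewrite /members big_seq_cond big1 // => h /andP[hh _].
  apply/eqP; rewrite eqb0; apply: contra hv => vh; apply/hasP; exists h => //.
  by rewrite -mem_undup.
case: gU exact_case random_case => [hs hsU|hs hsU|h hU|hs hsU] exact_case random_case.
- exists (fun s => [ffun x => test p (undup hs) s (fun h => ~~ a s h x)]); split=> [s|].
    have ht : bounded_poly (modular_over L w m (primes m)) 1 tau
        (fun x => (test p (undup hs) s (fun h => ~~ a s h x))%:R).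
      apply: (@bounded_poly_test L m w p tau 2 (undup hs) s (fun x h => ~~ a s h x)) => //.
        exact/w2/size_undup.
      by move=> h; rewrite mem_undup => /hsU; apply: hL2.
    apply: bounded_poly_weaken ht => //; last by move=> x; rewrite ffunE.
    by rewrite /t2; lia.
  apply: (random_case _ hs (fun x h => ~~ h x)) => // s x ea; rewrite !ffunE has_predC.
  rewrite (members_eq hs s _ (fun h : fn => ~~ h x)) //; last by move=> h hU; rewrite ea.
  rewrite (eq_all_r (mem_undup hs)).
  have := test_none hs s (fun h : fn => ~~ h x); rewrite has_predC negbK.
  by case: (all _ _) => [->|_] //; case: (test _ _ _ _).
- exists (fun s => [ffun x => ~~ test p (undup hs) s (fun h => a s h x)]); split=> [s|].
    have ht : bounded_poly (modular_over L w m (primes m)) 1 tau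
        (fun x => (test p (undup hs) s (fun h => a s h x))%:R).
      apply: (@bounded_poly_test L m w p tau 1 (undup hs) s (fun x h => a s h x)) => //.
        by apply: leq_trans (w2 _ (size_undup hs hsU)); rewrite leq_mul2r orbT.
      by move=> h; rewrite mem_undup => /hsU; apply: hL1.
    have tau_t2 : (tau <= t2)%N by rewrite /t2; lia.
    by apply: bounded_poly_weaken (compl _ tau tau_t2 ht) => // x; rewrite ffunE.
  apply: (random_case _ hs (fun x h => h x)) => // s x ea; rewrite !ffunE.
  rewrite (members_eq hs s _ (fun h : fn => h x)) //.
  rewrite (eq_has_r (mem_undup hs)).
  have := test_none hs s (fun h : fn => h x).
  by case: (has _ _) => [|->] //; case: (test _ _ _ _).
- exists (fun s => [ffun x => ~~ a s h x]); split=> [s|].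
    apply: bounded_poly_weaken (compl (a s h) 1%N _ _) => //.
      by move=> x; rewrite ffunE.
    by apply: bounded_poly_atom => //; left; apply: La.
  by apply: exact_case => s x ea; rewrite !ffunE ea.
have [hs' [hsU' sz hc]] := mod_reduce m0 hsU.
exists (fun s => [ffun x => m %| count (fun h : fn => h x) (map (a s) hs')]%N); split=> [s|].
  apply: bounded_poly_weaken (@mod_gate X L m M (map (a s) hs') m1 _ _) => //.
  - by rewrite /t2 /prime_exponents; lia.
  - by move=> x; rewrite ffunE.
  - by move=> h /mapP[h' h'U ->]; apply/La/hsU'.
  by rewrite size_map; apply: leq_trans sz _; rewrite leq_mul2l UM orbT.
apply: exact_case => s x ea; rewrite !ffunE /dvdn hc count_map.
by congr (_ %% _ == _)%N; apply: eq_in_count => h /hsU' hU /=; rewrite ea.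
Qed.

(** Layers are cumulative: each contains the previous one, so a function may feed gates arbitrarily
    far above it. *)
Inductive layered (base : fn -> Prop) (m : nat) : nat -> {set fn} -> Prop :=
| LayeredBase U of (forall g, g \in U -> base g) : layered base m 0 U
| LayeredStep D U (V : {set fn}) of layered base m D U &
    (forall g, g \in V -> g \in U \/ acc_gate m U g) : layered base m D.+1 (U :|: V).

Fixpoint poly_layers (base : fn -> Prop) (w m t2 D : nat) L : Prop :=
  if D is D'.+1 then
    exists L', poly_layers base w m t2 D' L' /\
      forall g, L g -> bounded_poly (modular_over L' w m (primes m)) 2 t2 (fun x => (g x)%:R)
  else forall g, L g -> base g.

(** Union bound over a shared seed: a seed that fails on [U :|: V] at [x] either fails on [U]
    already or errs at a new function all of whose inputs are right. *)
Lemma layered_approx base (m M tau D : nat) U :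
  (1 < m)%N -> layered base m D U -> (#|U| <= M)%N ->
  exists a : seed X tau -> fn -> fn,
    poly_layers base ((m * M).+1 ^ m) m (tau + prime_exponents m).+1 D
      (fun g => exists s h, h \in U /\ g = a s h) /\
    forall x, (#|[set s | ~~ [forall (h | h \in U), a s h x == h x]]| * 2 ^ tau
      <= #|U| * #|{: seed X tau}|)%N.
Proof.
move=> m1; elim=> {D U} [U hU|D U V lU IH hV] UM.
  exists (fun _ h => h); split=> [g [s [h [hh ->]]]|x]; first exact: hU.
  rewrite (_ : [set s | _] = set0) ?cards0 //.
  by apply/setP => s; rewrite !inE; apply/negbTE; rewrite negbK; apply/forall_inP.
have UM' : (#|U| <= M)%N by apply: leq_trans UM; apply/subset_leq_card/subsetUl.
have [a [ha ea]] := IH UM'.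
set L := (fun g => exists s h, h \in U /\ g = a s h) in ha.
have La s h : h \in U -> L (a s h) by move=> hU; exists s, h.
have step g : exists b : seed X tau -> fn, g \in V :\: U ->
    (forall s, bounded_poly (modular_over L ((m * M).+1 ^ m) m (primes m)) 2
       (tau + prime_exponents m).+1 (fun x => (b s x)%:R)) /\
    (forall x, #|[set s | (b s x != g x) && [forall (h | h \in U), a s h x == h x]]|
       * 2 ^ tau <= #|{: seed X tau}|)%N.
  case: (boolP (g \in V :\: U)) => [|_]; last by exists (fun=> g).
  rewrite inE => /andP[gU /hV[|hg]]; first by rewrite (negbTE gU).
  by have [b hb] := gate_approx m1 UM' La hg; exists b.
have [b hb] := fin_all_exists step.
exists (fun s g => if g \in U then a s g else b g s); split.
  exists L; split=> // g [s [h [hUV ->]]].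
  case: ifP => hU.
    apply: (bounded_poly_weaken (W := 1) (T := 1)
      (G := modular_over L ((m * M).+1 ^ m) m (primes m)) (F := fun x => (a s h x)%:R)) => //.
    by apply: bounded_poly_atom => //; left; apply: La.
  by apply: (hb h _).1; rewrite inE hU; move: hUV; rewrite inE hU.
move=> x.
pose bad := [set s | ~~ [forall (h | h \in U), a s h x == h x]].
pose badg g := [set s | (b g s x != g x) && [forall (h | h \in U), a s h x == h x]].
apply: (@leq_trans ((#|bad| + \sum_(g in V :\: U) #|badg g|) * 2 ^ tau)).
  rewrite leq_mul2r; apply/orP; right.
  apply: (@leq_trans #|bad :|: \bigcup_(g in V :\: U) badg g|).
    apply: subset_leq_card; apply/subsetP => s.
    rewrite !inE; case: (boolP [forall (h | h \in U), a s h x == h x]) => //= hs.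
    rewrite negb_forall_in => /exists_inP[g].
    rewrite inE; case: (boolP (g \in U)) => [gU _|gU /= gV ne].
      by move/forall_inP: hs => /(_ g gU) ->.
    by apply/bigcupP; exists g; rewrite !inE ?gU // ne.
  apply: leq_trans (leq_card_setU _ _) _; rewrite leq_add2l.
  elim/big_rec2: _ => [|g n S _ IHS]; first by rewrite cards0.
  by apply: leq_trans (leq_card_setU _ _) _; rewrite leq_add2l.
rewrite mulnDl big_distrl /=.
have -> : (#|U :|: V| = #|U| + #|V :\: U|)%N.
  by rewrite cardsU cardsD -addnBA ?[V :&: U]setIC // subset_leq_card // subsetIr.
rewrite mulnDl leq_add //; first exact: ea.
rewrite -sum_nat_const; apply: leq_sum => g gV.
exact: (hb g gV).2.
Qed.
End Layers.

(** * Depth reduction *)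

Section DepthReduction.
Set Implicit Arguments.
Unset Strict Implicit.
Variable n : nat.
Local Notation fn := {ffun n.-tuple bool -> bool}.

(** The constants come from the padding of majority gates. *)
Definition literal_or_constant (g : fn) : Prop :=
  (exists (i : 'I_n) (b : bool), g = [ffun x => tnth x i == b]) \/
  (exists b : bool, g = [ffun=> b]).

(** The list of terms is empty when a false constant kills the product, and otherwise holds the one
    conjunction of the literals. *)
Lemma monomial_term (t : seq fn) : (forall g, g \in t -> literal_or_constant g) ->
  exists ts : seq (seq ('I_n * bool)), (size ts <= 1)%N /\
    forall x, (count (term_value x) ts)%:Z = monomial t x.
Proof.
elim: t => [|g t IH] ht; first by exists [:: [::]].
have [ts [sz e]] := IH (fun h hh => ht h (mem_behead (s := g :: t) hh)).
have [[i [b eg]]|[[] eg]] := ht g (mem_head _ _).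
- exists (map (cons (i, b)) ts); split=> [|x]; first by rewrite size_map.
  rewrite monomial_cons -e eg ffunE count_map.
  have [xb|xb] := boolP (tnth x i == b).
    rewrite mul1r; congr (Posz _); apply: eq_count => l /=.
    by rewrite /term_value /= xb.
  rewrite mul0r (@eq_count _ _ pred0) ?count_pred0 // => l /=.
  by rewrite /term_value /= (negbTE xb).
- by exists ts; split=> // x; rewrite monomial_cons eg ffunE mul1r.
- by exists [::]; split=> // x; rewrite monomial_cons eg ffunE mul0r.
Qed.

(* A negative coefficient is replaced by [2W] copies, as [2W = -1] modulo
   [2W + 1]. *)
Lemma sym_and_of_sym_poly W T (f : fn) : (0 < W)%N ->
  sym_poly literal_or_constant W T f ->
  exists S : sym_and n, (sym_and_size S <= 2 * W * W)%N /\
    sym_and_computes S f.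
Proof.
move=> W0 [F [phi [hF ef]]].
have [s [sz hs eF]] := hF.
have [ts [tsz ets]] : exists ts : seq (seq ('I_n * bool)),
    (size ts <= 2 * W * size s)%N /\
    forall x, ((2 * W).+1%:Z %| (count (term_value x) ts)%:Z - signed_sum s x)%Z.
  elim: s hs {sz eF} => [|u s IH] hs.
    by exists [::]; split=> // x; rewrite /signed_sum big_nil subrr dvdz0.
  have [ts [tsz ets]] := IH (fun v vs => hs v (mem_behead (s := u :: s) vs)).
  have [r [rsz er]] := monomial_term (hs u (mem_head _ _)).2.
  exists (flatten (nseq (if u.1 then 2 * W else 1)%N r) ++ ts); split=> [|x].
    rewrite size_cat /= mulnS leq_add // size_flatten /shape map_nseq sumn_nseq.
    by case: u.1; [rewrite -[X in (_ <= X)%N]mul1n leq_mul | rewrite muln1; lia].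
  rewrite /signed_sum big_cons count_cat PoszD opprD addrACA rpredD //.
  rewrite count_flatten map_nseq sumn_nseq PoszM er; case: u.1.
    rewrite expr1 mulN1r opprK; apply/dvdzP; exists (monomial u.2 x).
    by rewrite intS mulrDr mulr1 addrC.
  by rewrite mulr1 mul1r subrr dvdz0.
(* The representative of [c] in the interval from [-W] to [W], where the values of [F] lie. *)
pose val_of (c : nat) : int := let q := (c %% (2 * W).+1)%N in
  if (q <= W)%N then q%:Z else q%:Z - (2 * W).+1%:Z.
exists (SymAnd ts (fun c => phi (val_of c))); split.
  by apply: leq_trans tsz _; rewrite leq_mul2l sz orbT.
move=> x; rewrite /sym_and_value /= ef; congr phi.
have := ets x; rewrite -eF; have := bounded_poly_norm x hF; rewrite /val_of.
set c := count _ _; set y := F x => yW.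
have := divn_eq c (2 * W).+1; have := ltn_pmod c (ltn0Sn (2 * W)).
set q := (c %% _)%N; set k := (c %/ _)%N => qW ->; case/dvdzP => j ej.
have {ej} : q%:Z - y = (j - k%:Z) * (2 * W).+1%:Z.
  by rewrite mulrBl -ej PoszD PoszM; ring.
set z := j - _ => ez.
have hz : z = 0 \/ z = 1 by nia.
by case: hz ez => ->; case: ifP; lia.
Qed.

Lemma eliminate_layers (base : fn -> Prop) (w m t2 D K B : nat) L f :
  (1 < m)%N -> (0 < K)%N -> (0 < B)%N -> (0 < t2)%N -> (w <= 2 ^ K)%N ->
  let q := ((20 * m.+1 ^ 2 * K) ^ size (primes m) * (2 * t2))%N in
  (q ^ D * B <= 2 ^ K)%N ->
  poly_layers base w m t2 D L -> sym_poly L (2 ^ B) B f ->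
  sym_poly base (2 ^ (q ^ D * B)) (q ^ D * B) f.
Proof.
move=> m1 K0 B0 t0 wK q.
have q0 : (0 < q)%N by rewrite !muln_gt0 expn_gt0 !muln_gt0 K0 t0.
elim: D L B B0 => [|D IH] L B B0 leB /=.
  by move=> hL; apply: sym_poly_weaken => //; rewrite mul1n.
move=> [L' [hL' hL]] hf; rewrite expnSr -mulnA; apply: (IH L') => //.
- by rewrite muln_gt0 q0.
- by rewrite mulnA -expnSr.
rewrite /q -[X in (2 ^ X)%N]mulnA -[X in sym_poly _ _ X]mulnA.
apply: (eliminate_level (w := w) (td := m)) hf => //.
- by apply/allP => p; rewrite mem_primes => /andP[].
- apply/allP => p; rewrite mem_primes => /and3P[_ m0 pm]; exact: dvdn_leq.
- rewrite mulnA; apply: leq_trans leB; apply: leq_mul => //.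
  rewrite -/q [X in (_ <= X)%N]expnS leq_pmulr //.
  by rewrite expn_gt0 q0.
Qed.

(** [K'] is such that the weight of the tests is at most [2 ^ K']. In each layer every prime costs a
    factor at most [c * K] and the opening of atoms one more, whence [r.+1]; the final [+ 1] in the
    exponent pays for [K.+1], the initial bound from the majority vote. *)
Lemma depth_reduction_arith (m K D r t : nat) : (1 < m)%N -> (0 < K)%N ->
  let K' := (2 * m ^ 2 * K)%N in
  let c := (100 * m.+1 ^ 4 * t.+1)%N in
  let B := (((20 * m.+1 ^ 2 * K') ^ r * (2 * (K + 4 + t).+1)) ^ D * K.+1)%N in
  [/\ ((m * 2 ^ K).+1 ^ m <= 2 ^ K')%N, (K <= K')%N,
    (B <= (c * K) ^ (r.+1 * D + 1))%N & (0 < (c * K) ^ (r.+1 * D + 1))%N].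
Proof.
move=> m1 K0 K' c B.
have [wK KK'] : ((m * 2 ^ K).+1 ^ m <= 2 ^ K')%N /\ (K <= K')%N; first split.
- apply: (@leq_trans ((2 ^ (m + K)) ^ m)).
    apply: leq_expn2r; rewrite expnD.
    have := ltn_expl m (isT : (1 < 2)%N); have : (0 < 2 ^ K)%N by rewrite expn_gt0.
    nia.
  rewrite -expnM; apply: leq_pexp2l => //.
  apply: (@leq_trans ((m * K + m * K) * m)).
    by rewrite leq_mul // leq_add // ?leq_pmulr // leq_pmull // ltnW.
  by rewrite /K' addnn -mul2n -mulnA mulnAC mulnn mulnA.
- by rewrite /K' leq_pmull // muln_gt0 expn_gt0 (ltnW m1).
have m4 : (m.+1 ^ 4 = m.+1 ^ 2 * m.+1 ^ 2)%N by rewrite -expnD.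
have leq_cK : (20 * m.+1 ^ 2 * K' <= c * K)%N.
  rewrite /K' /c m4; have : (m ^ 2 <= m.+1 ^ 2)%N by apply: leq_expn2r.
  move/(leq_mul (leqnn (m.+1 ^ 2))); set P := (m.+1 ^ 2 * m.+1 ^ 2)%N => hP.
  apply: (@leq_trans (40 * P * K)).
    rewrite [X in (X <= _)%N](_ : _ = 40 * (m.+1 ^ 2 * m ^ 2) * K)%N; last by ring.
    by rewrite leq_mul // leq_mul.
  rewrite leq_mul // -[X in (X <= _)%N]muln1; apply: leq_mul => //.
  by rewrite leq_mul.
have m40 : (0 < m.+1 ^ 4)%N by rewrite expn_gt0.
have leq_KS : (K.+1 <= c * K)%N.
  by rewrite /c; move: K0 m40; move: (m.+1 ^ 4)%N; clear; nia.
have cK0 : (0 < (c * K) ^ (r.+1 * D + 1))%N by rewrite expn_gt0 (leq_ltn_trans _ leq_KS).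
have leq_t2 : (2 * (K + 4 + t).+1 <= c * K)%N.
  by rewrite /c; move: K0 m40; move: (m.+1 ^ 4)%N; clear; nia.
split=> //; rewrite /B addn1 [X in (_ <= X)%N]expnSr; apply: leq_mul => //.
rewrite [X in (_ <= X)%N]expnM; apply: leq_expn2r.
rewrite [X in (_ <= X)%N]expnSr; apply: leq_mul => //.
exact: leq_expn2r.
Qed.

Lemma depth_reduction (m K D : nat) (U : {set fn}) (f : fn) :
  (1 < m)%N -> (0 < K)%N -> (n < 2 ^ K)%N ->
  layered literal_or_constant m D U -> (#|U| <= 2 ^ K)%N -> f \in U ->
  let c := (100 * m.+1 ^ 4 * (prime_exponents m).+1)%N in
  let e := ((size (primes m)).+1 * D + 1)%N in
  ((c * K) ^ e <= 2 ^ K)%N ->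
  exists S : sym_and n, (sym_and_size S <= 2 ^ (3 * (c * K) ^ e))%N /\
    sym_and_computes S f.
Proof.
move=> m1 K0 nK lU UK fU c e leB.
have [wK KK' qB cK0] := @depth_reduction_arith m K D (size (primes m)) (prime_exponents m) m1 K0.
set K' := (2 * m ^ 2 * K)%N in wK KK' qB.
have K'0 : (0 < K')%N := leq_trans K0 KK'.
set B := ((_ * _) ^ D * K.+1)%N in qB.
have B'K : (B <= 2 ^ K')%N.
  by apply: (leq_trans qB); apply: (leq_trans leB); apply: leq_pexp2l.
(* With [K + 4] sets per seed, the union bound over at most [2 ^ K] functions leaves a failing
   fraction of at most [1/16], as [derandomize] demands. *)
have [a [ha ea]] := layered_approx (K + 4) m1 lU UK.
set t2 := (K + 4 + _).+1 in ha.
have Om0 : (0 < #|{: seed (n.-tuple bool) (K + 4)}|)%N.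
  by apply/card_gt0P; exists [ffun=> set0].
have Xn : (#|{: n.-tuple bool}| <= 2 ^ n)%N by rewrite card_tuple card_bool.
have hbad x : (16 * #|[pred s | a s f x != f x]| <= #|{: seed (n.-tuple bool) (K + 4)}|)%N.
  have P0 : (0 < 2 ^ K)%N by rewrite expn_gt0.
  rewrite -(leq_pmul2l P0) mulnA -[16%N]/(2 ^ 4)%N -expnD mulnC.
  apply: leq_trans (_ : _ <= #|U| * #|{: seed (n.-tuple bool) (K + 4)}|)%N _; last first.
    by rewrite leq_mul2r UK orbT.
  apply: leq_trans (ea x); rewrite leq_mul2r; apply/orP; right.
  apply: subset_leq_card; apply/subsetP => s; rewrite !inE.
  by apply: contra => /forall_inP h; apply: h.
have [s [ss hs]] := @derandomize _ _ (fun s x => a s f x != f x) n Om0 Xn hbad.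
set L := (fun g => _) in ha.
(* The majority vote is a linear polynomial of weight [2 * n.+1], at most [2 ^ K.+1], followed by a
   threshold. *)
have hf : sym_poly L (2 ^ K.+1) K.+1 f.
  exists (fun x => \sum_(w <- s) (a w f x)%:R), (fun y => (size s)%:R < 2 * y); split.
    have := @bounded_poly_sum _ _ s xpredT L (fun=> 1%N) K.+1 (fun w x => (a w f x)%:R).
    case/(_ _) => [w _|l hl]; first by apply: bounded_poly_atom => //; exists w, f.
    apply: (bounded_poly_weaken (G := L) _ _ _ _ (ex_intro _ l hl)) => //.
    by rewrite sum1_size ss expnS leq_mul2l.
  move=> x; have := hs x; rewrite -(count_predC (fun w => a w f x != f x) s).
  have -> : \sum_(w <- s) (a w f x)%:R = (count (fun w => a w f x) s)%:R :> int.
    by rewrite -sum1_count natr_sum [RHS]big_mkcond /=; apply: eq_bigr => w _; case: (a w f x).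
  case fx : (f x).
    rewrite (@eq_count _ (predC _) (fun w => a w f x)); last first.
      by move=> w /=; rewrite negbK; case: (a w f x).
    by move: (count _ _) (count _ _); clear; lia.
  rewrite (@eq_count _ (fun w => a w f x != false) (fun w => a w f x)); last first.
    by move=> w /=; case: (a w f x).
  by move: (count _ _) (count _ _); clear; lia.
have h := eliminate_layers m1 K'0 (ltn0Sn K) (ltn0Sn _ : (0 < t2)%N) wK B'K ha hf.
have [|S [sS hS]] := sym_and_of_sym_poly _ h; first by rewrite expn_gt0.
exists S; split; last exact: hS.
apply: leq_trans sS _.
rewrite -mulnA -expnD -expnS; apply: leq_pexp2l => //; move: qB; rewrite -/B -/e -/c.
by move: cK0; rewrite -/c -/e; move: (B) (_ ^ e)%N; clear; lia.
Qed.
End DepthReduction.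

(** * Circuits as layers of functions *)

Section Circuits.
Set Implicit Arguments.
Unset Strict Implicit.

Section Foldl.
Variables (T : Type) (x0 : T) (step : seq T -> gate -> T).
Let run := foldl (fun vs g => rcons vs (step vs g)).

Lemma take_run s gs : take (size s) (run s gs) = s.
Proof.
elim: gs s => [|g gs IH] s /=; first by rewrite take_size.
have := IH (rcons s (step s g)); rewrite size_rcons => e.
by rewrite -(@take_takel _ (size s) (size s).+1) // e -cats1 take_size_cat.
Qed.

Lemma nth_run_prefix s gs i : (i < size s)%N -> nth x0 (run s gs) i = nth x0 s i.
Proof. by move=> ilt; rewrite -[in RHS](take_run s gs) nth_take. Qed.

Lemma nth_run s gs g0 j : (j < size gs)%N ->
  nth x0 (run s gs) (size s + j) =
  step (take (size s + j) (run s gs)) (nth g0 gs j).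
Proof.
elim: gs s j => [//|g gs IH] s [|j] /= ltj.
  rewrite addn0 (nth_run_prefix (s := rcons _ _)) ?size_rcons // nth_rcons ltnn eqxx.
  congr step; rewrite -(@take_takel _ (size s) (size s).+1) //.
  have := take_run (rcons s (step s g)) gs; rewrite size_rcons => ->.
  by rewrite -cats1 take_size_cat.
by have := IH (rcons s (step s g)) j ltj; rewrite size_rcons addSnnS.
Qed.
End Foldl.

Lemma gate_value_ext (v v' : nat -> bool) g :
  {in wires g, v =1 v'} -> gate_value v g = gate_value v' g.
Proof.
case: g => [ws|ws|w|m ws|ws] /= e.
- exact: eq_in_all.
- exact: eq_in_has.
- by rewrite e // mem_head.
- by rewrite (eq_in_count e).
- by congr majority; apply/eq_in_map.
Qed.

Lemma topological_nth k gs g0 j : topological k gs -> (j < size gs)%N ->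
  {in wires (nth g0 gs j), forall w, (w < k + j)%N}.
Proof.
elim: gs k j => [//|g gs IH] k [|j] /= /andP[/allP h ht] ltj w wj.
  by rewrite addn0; apply: h.
by have := IH k.+1 j ht ltj w wj; rewrite addSnnS.
Qed.

Section Nodes.
Variables (n : nat) (C : circuit n).

Definition node (x : n.-tuple bool) (v : nat) : bool := nth false (node_values C x) v.
Definition depth_of (v : nat) : nat := nth 0%N (node_depths C) v.
Definition gate_at (j : nat) : gate := nth (NOT 0) (gates C) j.

Lemma node_input x i : (i < n)%N -> node x i = nth false x i.
Proof. by move=> ilt; rewrite /node /node_values nth_run_prefix ?size_tuple. Qed.

Lemma node_gate x j : (j < size (gates C))%N ->
  node x (n + j) = gate_value (node x) (gate_at j).
Proof.
move=> ltj.
have := @nth_run _ false (fun vs g => gate_value (nth false vs) g) x _ (NOT 0) j ltj.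
rewrite size_tuple {1}/node /node_values => ->; apply: gate_value_ext => w wj; rewrite nth_take //.
exact: topological_nth (gates_topological C) ltj w wj.
Qed.

Lemma depth_of_input i : (i < n)%N -> depth_of i = 0%N.
Proof.
by move=> ilt; rewrite /depth_of /node_depths nth_run_prefix ?size_nseq // nth_nseq ilt.
Qed.

Lemma depth_of_gateE j : (j < size (gates C))%N ->
  depth_of (n + j) =
  (\max_(w <- wires (gate_at j)) nth 0%N (take (n + j) (node_depths C)) w).+1.
Proof.
move=> ltj; have := @nth_run _ 0%N
  (fun ds g => (\max_(w <- wires g) nth 0%N ds w).+1) (nseq n 0%N) _ (NOT 0) j ltj.
by rewrite size_nseq.
Qed.

Lemma depth_of_wire j w : (j < size (gates C))%N -> w \in wires (gate_at j) ->
  (depth_of w < depth_of (n + j))%N.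
Proof.
move=> ltj wj; rewrite depth_of_gateE // ltnS.
apply: leq_trans (_ : _ <= nth 0 (take (n + j) (node_depths C)) w)%N _.
  by rewrite nth_take // (@topological_nth _ _ (NOT 0) _ (gates_topological C) ltj _ wj).
exact: (leq_bigmax_seq (F := fun w => nth 0%N (take (n + j) (node_depths C)) w)).
Qed.

Lemma depth_of_gate j : (j < size (gates C))%N -> (0 < depth_of (n + j))%N.
Proof.
by move=> ltj; rewrite depth_of_gateE.
Qed.

Lemma wire_lt j w : (j < size (gates C))%N -> w \in wires (gate_at j) -> (w < n + j)%N.
Proof. by move=> ltj; apply: topological_nth (gates_topological C) ltj w. Qed.
End Nodes.


(** * Functions substituted for the inputs of a circuit *)

Section Substitution.
Variables (X : finType) (n m : nat) (C : circuit n).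
Local Notation fn := {ffun X -> bool}.
Implicit Types (hs : n.-tuple fn) (Hs : seq (n.-tuple fn)).

Definition sub_node hs (v : nat) : fn :=
  [ffun x => node C (map_tuple (fun h : fn => h x) hs) v].

Definition sub_nodes Hs : {set fn} :=
  [set g in [seq sub_node hs v | hs <- Hs, v <- iota 0 (n + size (gates C))]].

Lemma card_sub_nodes Hs : (#|sub_nodes Hs| <= size Hs * (n + size (gates C)))%N.
Proof.
rewrite cardsE; apply: leq_trans (card_size _) _.
by rewrite size_allpairs size_iota.
Qed.

Lemma sub_node_input hs (v : 'I_n) : sub_node hs v = tnth hs v.
Proof.
apply/ffunP => x; rewrite ffunE node_input //.
by rewrite -tnth_nth tnth_map.
Qed.

Lemma acc_sub_node hs j (U : {set fn}) : ACC0_circuit m C ->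
  (j < size (gates C))%N ->
  (forall w, w \in wires (gate_at C j) -> sub_node hs w \in U) ->
  acc_gate m U (sub_node hs (n + j)).
Proof.
move=> /all_nthP hC ltj hw; have := hC (NOT 0) j ltj.
have e : sub_node hs (n + j) = [ffun x => gate_value (fun w => sub_node hs w x) (gate_at C j)].
  apply/ffunP => x; rewrite !ffunE node_gate //; apply: gate_value_ext => w _.
  by rewrite ffunE.
rewrite e -/(gate_at C j); case: (gate_at C j) hw => [ws|ws|w|q ws|ws] //= hw.
- move=> _; rewrite (_ : [ffun x => _] =
    [ffun x => all (fun h : fn => h x) (map (sub_node hs) ws)]); last first.
    by apply/ffunP => x; rewrite !ffunE all_map.
  by apply: AccAnd => h /mapP[w wj ->]; apply: hw.
- move=> _; rewrite (_ : [ffun x => _] =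
    [ffun x => has (fun h : fn => h x) (map (sub_node hs) ws)]); last first.
    by apply/ffunP => x; rewrite !ffunE has_map.
  by apply: AccOr => h /mapP[w wj ->]; apply: hw.
- by move=> _; apply: AccNot; apply: hw; rewrite mem_head.
move=> /eqP ->; rewrite (_ : [ffun x => _] =
    [ffun x => m %| count (fun h : fn => h x) (map (sub_node hs) ws)]%N); last first.
  by apply/ffunP => x; rewrite !ffunE count_map.
by apply: AccMod => h /mapP[w wj ->]; apply: hw.
Qed.

(** All copies of [C] advance in parallel, one layer for each level of depth, so their number
    affects the size of the layers only. *)
Lemma layered_sub_nodes base D (U : {set fn}) Hs e : ACC0_circuit m C ->
  layered base m D U ->
  (forall hs, hs \in Hs -> forall i, tnth hs i \in U) ->
  exists V : {set fn}, [/\ layered base m (D + e) V, U \subset V,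
    V \subset U :|: sub_nodes Hs &
    forall hs v, hs \in Hs -> (v < n + size (gates C))%N -> (depth_of C v <= e)%N ->
      sub_node hs v \in V].
Proof.
move=> hC lU HsU; elim: e => [|e [V [lV UV VU hV]]].
  exists U; rewrite addn0; split=> //; first exact: subsetUl.
  move=> hs v hHs vlt; case: (ltnP v n) => [vn _|nv].
    by have := sub_node_input hs (Ordinal vn) => /= ->; apply: HsU.
  have := @depth_of_gate _ C (v - n); rewrite subnKC // leqn0 => h /eqP h0.
  by move: h; rewrite h0 => /(_ _); rewrite ltn_subLR // => /(_ vlt).
pose V' : {set fn} := [set g in [seq sub_node hs v | hs <- Hs,
   v <- [seq v <- iota 0 (n + size (gates C)) | depth_of C v <= e.+1]%N]].
exists (V :|: V'); split.
- rewrite addnS; apply: LayeredStep => // g.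
  rewrite inE => /allpairsP[[hs v] /= [hHs]]; rewrite mem_filter mem_iota add0n.
  move=> /andP[dv /andP[_ vlt]] ->; case: (ltnP v n) => [vn|nv].
    left; have := sub_node_input hs (Ordinal vn) => /= ->.
    by apply: (subsetP UV); apply: HsU.
  right; have jlt : (v - n < size (gates C))%N by rewrite ltn_subLR.
  rewrite -(subnKC nv); apply: acc_sub_node => // w wj.
  apply: hV => //.
    by apply: leq_trans (wire_lt jlt wj) _; rewrite leq_add2l ltnW.
  have := depth_of_wire jlt wj; rewrite subnKC // => h.
  by rewrite -ltnS; apply: leq_trans dv.
- exact: subset_trans UV (subsetUl _ _).
- rewrite subUset VU /=; apply: subset_trans (subsetUr _ _).
  apply/subsetP => g; rewrite !inE => /allpairsP[[hs v] /= [hHs]].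
  rewrite mem_filter => /andP[_ hv] ->; exact: allpairs_f.
move=> hs v hHs vlt dv; rewrite inE; apply/orP; right; rewrite inE.
by apply: allpairs_f => //; rewrite mem_filter dv mem_iota.
Qed.
End Substitution.
End Circuits.

(** * Majority gates replaced by ACC0 circuits *)

(* [majority s] amounts to [uphalf (size s) <= count id s]. *)
Lemma majority_pad (n : nat) (s : seq bool) : (size s <= n)%N ->
  let p := (uphalf n - uphalf (size s))%N in
  let s' := s ++ nseq p true ++ nseq (n - size s - p) false in
  size s' = n /\ majority s' = majority s.
Proof.
move=> sn p s'; have hs := uphalf_leq sn.
have pn : (p <= n - size s)%N by rewrite /p !uphalf_half; lia.
have ss : size s' = n by rewrite /s' !size_cat !size_nseq; lia.
split=> //; rewrite /majority ss -!leq_uphalf_double /s' !count_cat !count_nseq /=.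
by rewrite mul1n mul0n addn0 /p; lia.
Qed.

Section Composition.
Set Implicit Arguments.
Unset Strict Implicit.
Variables (N n m d : nat) (T : circuit N) (C : circuit n).
Hypotheses (T_TC0 : TC0_circuit T) (T_fan_in : fan_in_le T n).
Hypotheses (C_ACC0 : ACC0_circuit m C) (C_depth : (circuit_depth C <= d)%N).
Hypothesis C_majority : computes C (@MAJORITY n).
Local Notation fn := {ffun N.-tuple bool -> bool}.

Definition node_fn (v : nat) : fn := [ffun x => node T x v].

(** When [ws] has at most [n] wires the list has length [n] by [majority_pad]; the all-false tuple
    is only the default of [insubd]. *)
Definition padded (ws : seq nat) : n.-tuple fn :=
  let p := (uphalf n - uphalf (size ws))%N in
  insubd (nseq_tuple n [ffun=> false])
    (map node_fn ws ++ nseq p [ffun=> true] ++ nseq (n - size ws - p) [ffun=> false]).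

Lemma padded_mem ws i : (exists b : bool, tnth (padded ws) i = [ffun=> b]) \/
  exists2 w, w \in ws & tnth (padded ws) i = node_fn w.
Proof.
have : tnth (padded ws) i \in tval (padded ws) := mem_tnth _ _.
move: (tnth _ _) => h; rewrite [tval _]val_insubd; case: ifP => _ /=.
  rewrite !mem_cat => /or3P[/mapP[w wj ->]|/nseqP[-> _]|/nseqP[-> _]].
  - by right; exists w.
  - by left; exists true.
  - by left; exists false.
by case/nseqP => -> _; left; exists false.
Qed.

Lemma sub_node_padded ws : (size ws <= n)%N ->
  sub_node C (padded ws) (output C) = [ffun x => majority [seq node_fn w x | w <- ws]].
Proof.
move=> wn; apply/ffunP => x; rewrite !ffunE -[LHS]/(circuit_value C _) C_majority.
have sz : size [seq node_fn w x | w <- ws] = size ws by rewrite size_map.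
have := @majority_pad n [seq node_fn w x | w <- ws]; rewrite sz => /(_ wn) [ss <-].
rewrite /MAJORITY; congr majority; rewrite /= [tval _]val_insubd.
have -> : size (map node_fn ws ++
    nseq (uphalf n - uphalf (size ws)) [ffun=> true] ++
    nseq (n - size ws - (uphalf n - uphalf (size ws))) [ffun=> false]) == n.
  by rewrite -[X in _ == X]ss !size_cat !size_map !size_nseq.
by rewrite !map_cat -map_comp !map_nseq !ffunE.
Qed.

Lemma output_lt : (output C < n + size (gates C))%N.
Proof. exact: output_node. Qed.

Definition instances (ok : pred nat) : seq (n.-tuple fn) :=
  [seq padded (wires (gate_at T j)) | j <- iota 0 (size (gates T)) & ok j].

(** One set that contains all the layers, so that their size is bounded by counting nodes once. *)
Definition all_functions : {set fn} :=
  [set [ffun=> true]; [ffun=> false]] :|: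
  [set g in [seq node_fn v | v <- iota 0 (N + size (gates T))]] :|:
  sub_nodes C (instances xpredT).

Lemma card_all_functions :
  (#|all_functions| <= 2 + (N + size (gates T)) +
     size (gates T) * (n + size (gates C)))%N.
Proof.
apply: leq_trans (leq_card_setU _ _) _; apply: leq_add.
  apply: leq_trans (leq_card_setU _ _) _; apply: leq_add.
    by rewrite cards2; case: (_ != _).
  rewrite cardsE; apply: leq_trans (card_size _) _.
  by rewrite size_map size_iota.
apply: leq_trans (card_sub_nodes _ _) _.
by rewrite size_map size_filter count_predT size_iota.
Qed.

Lemma sub_nodes_instances ok : sub_nodes C (instances ok) \subset all_functions.
Proof.
apply: subset_trans (subsetUr _ _); apply/subsetP => g.
rewrite !inE => /allpairsP[[hs v] /= [/mapP[j]]].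
rewrite mem_filter => /andP[_ hj] -> hv ->; apply: allpairs_f => //.
by apply: map_f; rewrite mem_filter.
Qed.

Lemma node_fn_all v : (v < N + size (gates T))%N -> node_fn v \in all_functions.
Proof.
move=> vlt; rewrite /all_functions !inE -!orbA; apply/or4P; apply: Or43.
by apply: map_f; rewrite mem_iota.
Qed.

(** One level of [T] costs [d] layers for the copies of [C] that replace its majority gates, and one
    further layer, which applies the NOT gates and collects the nodes. *)
Lemma layered_TC0 i : exists U : {set fn},
  [/\ layered (@literal_or_constant N) m (i * d.+1) U,
      U \subset all_functions,
      forall b : bool, [ffun=> b] \in U &
      forall v, (v < N + size (gates T))%N -> (depth_of T v <= i)%N -> node_fn v \in U].
Proof.
elim: i => [|i [U [lU UA Uc hU]]].
  exists ([set [ffun=> true]; [ffun=> false]] :|: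
     [set g in [seq node_fn v | v <- iota 0 N]]); split.
  - apply: LayeredBase => g; rewrite !inE => /orP[/orP[]/eqP->|/mapP[v]].
    + by right; exists true.
    + by right; exists false.
    rewrite mem_iota add0n => /andP[_ vN] ->; left; exists (Ordinal vN), true.
    apply/ffunP => x; rewrite !ffunE node_input // (tnth_nth false) /=.
    by case: (nth _ _ _).
  - apply: subset_trans (subsetUl _ _); apply: setUS.
    apply/subsetP => g; rewrite !inE => /mapP[v]; rewrite mem_iota add0n.
    move=> /andP[_ vN] ->; apply: map_f; rewrite mem_iota /=.
    exact: leq_trans vN (leq_addr _ _).
  - by case; rewrite !inE eqxx ?orbT.
  move=> v vlt dv; rewrite !inE; apply/orP; right; apply: map_f; rewrite mem_iota /=.
  case: (ltnP v N) => // Nv; have jlt : (v - N < size (gates T))%N by rewrite ltn_subLR.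
  by have := depth_of_gate jlt; rewrite subnKC // ltnNge dv.
(* Copies of [C] are made only for gates up to the current depth, as their inputs have to lie in [U]
   already. *)
pose ok j := (depth_of T (N + j) <= i.+1)%N.
have wires_U j w : (j < size (gates T))%N -> ok j -> w \in wires (gate_at T j) ->
    node_fn w \in U.
  move=> jlt okj wj; apply: hU.
    by apply: leq_trans (wire_lt jlt wj) _; rewrite leq_add2l ltnW.
  by have := depth_of_wire jlt wj; move/leq_trans/(_ okj); rewrite ltnS.
have inst hs : hs \in instances ok -> forall k, tnth hs k \in U.
  case/mapP => j; rewrite mem_filter mem_iota add0n => /andP[okj /andP[_ jlt]] -> k.
  by case: (padded_mem (wires (gate_at T j)) k) => [[b ->]|[w wj ->]] //; apply: wires_U wj.
have [V [lV UV VU hV]] := layered_sub_nodes d C_ACC0 lU inst.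
pose V' : {set fn} := [set g in [seq node_fn v | v <-
   [seq v <- iota 0 (N + size (gates T)) | depth_of T v <= i.+1]%N]].
exists (V :|: V'); split.
- rewrite mulSnr addnS; apply: LayeredStep => // g.
  rewrite inE => /mapP[v]; rewrite mem_filter mem_iota add0n => /andP[dv /andP[_ vlt]] ->.
  case: (ltnP v N) => [vN|Nv].
    by left; apply: (subsetP UV); apply: hU => //; rewrite depth_of_input.
  have jlt : (v - N < size (gates T))%N by rewrite ltn_subLR.
  have okj : ok (v - N)%N by rewrite /ok subnKC.
  have ev : node_fn v = [ffun x => gate_value (fun w => node_fn w x) (gate_at T (v - N))].
    apply/ffunP => x; rewrite !ffunE -{1}(subnKC Nv) node_gate //.
    by apply: gate_value_ext => w _; rewrite ffunE.
  have := elimT (all_nthP (NOT 0)) T_TC0 _ jlt.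
  have := elimT (all_nthP (NOT 0)) T_fan_in _ jlt.
  have hw := wires_U _ _ jlt okj.
  rewrite ev -/(gate_at T (v - N)).
  have hin : padded (wires (gate_at T (v - N))) \in instances ok.
    by apply: map_f; rewrite mem_filter okj mem_iota.
  case: (gate_at T _) hw hin => [ws|ws|w|q ws|ws] //= hw hin szw _.
    right; rewrite (_ : [ffun x => _] = [ffun x => ~~ node_fn w x]); last first.
      by apply/ffunP => x; rewrite !ffunE.
    by apply: AccNot; apply: (subsetP UV); apply: hw; rewrite mem_head.
  by left; rewrite -sub_node_padded //; apply: hV => //; exact: output_lt.
- apply/subsetP => g; rewrite inE => /orP[/(subsetP VU)|].
    rewrite inE => /orP[/(subsetP UA)//|].
    exact: (subsetP (sub_nodes_instances ok)).
  rewrite inE => /mapP[v]; rewrite mem_filter mem_iota add0n => /andP[_ /andP[_ vlt]] ->.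
  exact: node_fn_all.
- by move=> b; rewrite inE (subsetP UV).
move=> v vlt dv; rewrite inE; apply/orP; right; rewrite inE.
by apply: map_f; rewrite mem_filter dv mem_iota.
Qed.
End Composition.

Lemma sym_and_of_TC0 (N n m d c K : nat) (T : circuit N) (C : circuit n)
    (f : N.-tuple bool -> bool) :
  (1 < m)%N -> (0 < K)%N ->
  TC0_circuit T -> fan_in_le T n -> (circuit_depth T <= c)%N -> computes T f ->
  ACC0_circuit m C -> (circuit_depth C <= d)%N -> computes C (@MAJORITY n) ->
  (2 + (N + circuit_size T) + circuit_size T * (n + circuit_size C) <= 2 ^ K)%N ->
  let a := (100 * m.+1 ^ 4 * (prime_exponents m).+1)%N in
  let e := ((size (primes m)).+1 * (c * d.+1) + 1)%N in
  ((a * K) ^ e <= 2 ^ K)%N ->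
  exists S : sym_and N, (sym_and_size S <= 2 ^ (3 * (a * K) ^ e))%N /\
    sym_and_computes S f.
Proof.
move=> m1 K0 hT hw hc hf hC hd hM hK a e he.
have [U [lU UA _ hU]] := layered_TC0 hT hw hC hd hM c.
have fU : [ffun x => f x] \in U.
  have -> : [ffun x => f x] = node_fn T (output T).
    by apply/ffunP => x; rewrite !ffunE -hf.
  exact: hU (output_node T) hc.
have NK : (N < 2 ^ K)%N.
  apply: leq_trans hK; apply: leq_trans (leq_addr _ _).
  by rewrite addnCA -[X in (X < _)%N]addn0 ltn_add2l.
have UK : (#|U| <= 2 ^ K)%N.
  by apply: leq_trans hK; apply: leq_trans (card_all_functions _ _); apply: subset_leq_card UA.
have [S [sS hS]] := depth_reduction m1 K0 NK lU UK fU he.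
exists S; split; first exact: sS.
by move=> x; rewrite hS ffunE.
Qed.

(** * Asymptotics *)

(** Since [expR y] is the [e.+1]-st power of [expR (y / e.+1)], it is at least the [e.+1]-st power
    of [y / e.+1], one degree more than [y ^+ e]. *)
Lemma expR_dominates (R : realType) (A : R) (e : nat) :
  exists Y : R, forall y, Y <= y -> A * y ^+ e <= expR y.
Proof.
exists (`|A| * e.+1%:R ^+ e.+1) => y hy.
have e0 : 0 < e.+1%:R :> R by rewrite ltr0n.
have y0 : 0 <= y by apply: le_trans hy; rewrite mulr_ge0 // exprn_ge0 // ltW.
apply: (@le_trans _ _ ((y / e.+1%:R) ^+ e.+1)).
  rewrite expr_div_n ler_pdivlMr ?exprn_gt0 // [leRHS]exprS mulrAC.
  rewrite ler_wpM2r ?exprn_ge0 //; apply: le_trans hy.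
  by rewrite ler_wpM2r ?exprn_ge0 ?(ltW e0) // ler_norm.
have -> : expR y = expR (y / e.+1%:R) ^+ e.+1.
  by rewrite -expRM_natl mulrC divfK ?gt_eqF.
apply: lerXn2r; rewrite ?nnegrE ?expR_ge0 ?divr_ge0 ?(ltW e0) //.
by apply: le_trans (expR_ge1Dx _); rewrite lerDr.
Qed.

(** Apply [expR_dominates] at the logarithm of [n]. The square is the right scale: if [N * N <= n],
    then the hard circuit on [N] inputs has at most [n] gates, each of fan-in at most [n]. *)
Lemma quasilinear_le_square (R : realType) (t : nat -> nat) : quasilinear R t ->
  exists n0, forall n, (n0 <= n)%N -> (t n <= n * n)%N.
Proof.
case=> A [e [n1 _ hn1]]; have [Y hY] := @expR_dominates R A e.
exists (maxn (maxn n1 1) (Num.truncn (expR Y)).+1) => n; rewrite !geq_max -andbA => /and3P[n1n n0 Yn].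
have nR : 0 < n%:R :> R by rewrite ltr0n.
rewrite -(ler_nat R) natrM; apply: le_trans (hn1 n n1n) _.
rewrite mulrAC ler_wpM2r ?(ltW nR) // -[leRHS](lnK (x := n%:R)) ?posrE //.
apply: hY; rewrite -ler_expR lnK ?posrE //.
apply: ltW; apply: lt_le_trans (truncnS_gt _) _; by rewrite ler_nat.
Qed.

Lemma nat_sqrt (n : nat) : exists N, (N * N <= n < N.+1 * N.+1)%N.
Proof.
elim: n => [|n [N /andP[h1 h2]]]; first by exists 0%N.
have [h|h] := ltnP n.+1 (N.+1 * N.+1).
  by exists N; rewrite h andbT; apply: leq_trans h1 _.
by exists N.+1; rewrite h /=; nia.
Qed.

Lemma powR_unbounded (R : realType) (delta A : R) : 0 < delta ->
  exists n0, forall n, (n0 <= n)%N -> A <= n%:R `^ delta.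
Proof.
move=> d0; exists (Num.truncn (`|A| `^ delta^-1)).+1 => n hn.
apply: le_trans (ler_norm A) _.
have -> : `|A| = (`|A| `^ delta^-1) `^ delta.
  by rewrite -powRrM mulVf ?gt_eqF // powRr1.
apply: ge0_ler_powR; rewrite ?nnegrE ?powR_ge0 ?ler0n ?(ltW d0) //.
apply: ltW; apply: lt_le_trans (truncnS_gt _) _; by rewrite ler_nat.
Qed.

Lemma pow2_expR (R : realType) (j : nat) : (2 ^ j)%N%:R = expR (j%:R * ln 2) :> R.
Proof. by rewrite natrX expRM_natl lnK // posrE. Qed.

Lemma ln2_bounds (R : realType) : 2^-1 <= ln (2 : R) <= 1.
Proof.
apply/andP; split; last by apply: (@le_ln1Dx R 1); lra.
have : ln (1 + - 2^-1 : R) <= - 2^-1 by apply: le_ln1Dx; lra.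
have -> : 1 + - 2^-1 = 2^-1 :> R by lra.
by rewrite lnV ?posrE // lerN2.
Qed.

Local Open Scope classical_set_scope.

Theorem theorem1p8 (R : realType) :
  SYM_AND_hypothesis R ->
  exists alpha : R, 0 < alpha /\
    forall m d : nat, (1 < m)%N -> (0 < d)%N ->
      \forall n \near \oo,
        forall C : circuit n,
          ACC0_circuit m C -> (circuit_depth C <= d)%N ->
          computes C (@MAJORITY n) ->
          expR (n%:R `^ (alpha / (size (primes m) * d)%:R)) <=
            (circuit_size C)%:R.
Proof.
case=> c [k [f [s [w [[c1 k1] [hs hw] [NT _ hT] hS]]]]].
have k0 : 0 < k by apply: lt_trans k1.
have c0 : 0 < c%:R :> R by rewrite ltr0n ltnW.
(* Chosen so that [eps * e <= 1 / (4k)], where [e] is the exponent of the depth reduction: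
   [e <= 5 * c * (r * d)], and [20 = 4 * 5]. *)
set alpha := (20 * c%:R * k)^-1.
exists alpha; split; first by rewrite invr_gt0 !mulr_gt0.
move=> m d m1 d0; set r := size (primes m).
have r0 : (0 < r)%N.
  by rewrite /r lt0n size_eq0; apply: contraTneq m1 => /eqP; rewrite primes_eq0 -ltnNge.
set eps := alpha / _.
have eps0 : 0 < eps by rewrite divr_gt0 ?invr_gt0 ?mulr_gt0 // ltr0n muln_gt0 r0.
have [a ea] : exists a, (100 * m.+1 ^ 4 * (prime_exponents m).+1)%N = a by eexists.
pose e := (r.+1 * (c * d.+1) + 1)%N.
have eps_e : eps * e%:R <= (4 * k)^-1.
  have e5 : (e <= 5 * c * (r * d))%N.
    have : (r.+1 * (c * d.+1) <= 2 * r * (c * (2 * d)))%N by rewrite leq_mul ?leq_mul //; lia.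
    have : (0 < c * (r * d))%N by rewrite !muln_gt0 r0 d0 ltnW.
    rewrite /e; clear; nia.
  apply: (@le_trans _ _ (eps * (5 * c * (r * d))%:R)); first by rewrite ler_pM2l ?ler_nat.
  rewrite /eps /alpha natrM natrM le_eqVlt; apply/orP; left; apply/eqP; field.
  by rewrite ?(gt_eqF k0) ?(gt_eqF c0) ?pnatr_eq0 ?muln_eq0 -?lt0n ?negb_or ?r0 ?d0 -?lt0n ?r0 ?d0.
(* The constant [2] is the one that appears in [zN], where the exponent is compared with a power of
   [N]. *)
have [NS _ hSN] := hS 2.
have [Ns hNs] := @quasilinear_le_square R _ hs.
have [Nw hNw] := @quasilinear_le_square R _ hw.
(* With this [j], [n ^ 2] is at most the [j]-th power of [n ^ eps], which the exponential
   dominates. *)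
have [j hj] : exists j : nat, 2 <= eps * j%:R.
  exists (Num.truncn (2 / eps)).+1; rewrite mulrC -ler_pdivrMr //.
  exact/ltW/truncnS_gt.
have [Y hY] := @expR_dominates R 8 j.
have [n1 hn1] := @powR_unbounded R eps Y eps0.
have k4 : 0 < (4 * k)^-1 by rewrite invr_gt0 mulr_gt0.
have [n2 hn2] := @powR_unbounded R (4 * k)^-1 (3 * (5 * a%:R) ^+ e) k4.
pose N0 := maxn (maxn NT NS) (maxn Ns Nw).
exists (maxn (maxn n1 n2) (N0.+1 * N0.+1)) => // n /=.
rewrite !geq_max -andbA => /and3P[n1n n2n N0n] C hC hd hM.
have [N /andP[NNn nNN]] := nat_sqrt n.
have N0N : (N0 <= N)%N by rewrite leqNgt; apply/negP => ?; nia.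
move: N0N; rewrite /N0 !geq_max => /andP[/andP[NTN NSN] /andP[NsN NwN]].
have n0 : (0 < n)%N by apply: leq_trans N0n.
have nR1 : 1 <= n%:R :> R by rewrite ler1n.
have nR0 : 0 < n%:R :> R by rewrite ltr0n.
rewrite leNgt; apply/negP => sizeC.
set x := n%:R `^ eps in sizeC.
have x1 : 1 <= x by rewrite -(powRr0 n%:R) ler_powR // ltW.
have /andP[ln2l ln2u] := ln2_bounds R.
have n2E : 8 * n%:R ^+ 2 <= expR x.
  apply: le_trans (hY x (hn1 n n1n)); rewrite ler_wpM2l //.
  rewrite -!powR_mulrn ?powR_ge0 // /x -powRrM ler_powR //.
(* [K] lies between [4 * x] and [5 * x]. Since [ln 2] is at least [1/2], [2 ^ K] is at least
   [expR (2 * x)], which exceeds the number of nodes after substitution; yet [K] remains linear in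
   [x]. *)
pose K := (Num.truncn (4 * x)).+1.
have K4 : 4 * x < K%:R by apply: truncnS_gt.
have K5 : K%:R <= 5 * x.
  have : (Num.truncn (4 * x))%:R <= 4 * x by rewrite truncn_le mulr_ge0 ?(le_trans ler01 x1).
  by rewrite /K -natr1; move: x1; clear; lra.
have E2K : expR (2 * x) <= (2 ^ K)%N%:R.
  by rewrite pow2_expR ler_expR; move: K4 ln2l x1; clear; nra.
have E1 : 1 <= expR x by apply: le_trans (expR_ge1Dx x); rewrite lerDl (le_trans ler01 x1).
set z := n%:R `^ (2 * k)^-1.
(* Half of the exponent of [z] absorbs the constant [3 * (5 * a) ^ e], for large [n], and the other
   half absorbs [x ^ e]. *)
have zK : 3 * (a%:R * K%:R) ^+ e <= z.
  apply: (@le_trans _ _ (3 * (5 * a%:R) ^+ e * x ^+ e)).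
    rewrite -mulrA -exprMn ler_wpM2l //; apply: lerXn2r; rewrite ?nnegrE ?mulr_ge0 ?ler0n //.
      exact: le_trans ler01 x1.
    by rewrite mulrAC [leLHS]mulrC ler_wpM2r ?ler0n.
  have -> : z = n%:R `^ (4 * k)^-1 * n%:R `^ (4 * k)^-1.
    rewrite -powRD ?(gt_eqF nR0) ?implybT // /z; congr (_ `^ _).
    by field; rewrite gt_eqF.
  apply: ler_pM; first by rewrite mulr_ge0 ?exprn_ge0 ?mulr_ge0 ?ler0n.
  - by rewrite exprn_ge0 // powR_ge0.
  - exact: hn2.
  by rewrite -powR_mulrn ?powR_ge0 // /x -powRrM ler_powR.
have zn : z <= n%:R.
  rewrite -[leRHS]powRr1 ?ler0n // /z ler_powR // invf_le1 ?mulr_gt0 //.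
  by move: k1; clear; lra.
(* The square root of [n] is at most [2 * N], and [2] to the power [1 / k] is at most [2] because
   [k > 1]. *)
have zN : z <= 2 * N%:R `^ k^-1.
  have N1 : (0 < N)%N by case: (N) nNN n0 => //; case: (n).
  rewrite /z invfM powRrM powR12_sqrt ?ler0n //.
  apply: (@le_trans _ _ ((2 * N%:R) `^ k^-1)).
    apply: ge0_ler_powR; rewrite ?nnegrE ?invr_ge0 ?(ltW k0) ?sqrtr_ge0 ?mulr_ge0 ?ler0n //.
    rewrite -[leRHS]ger0_norm ?mulr_ge0 ?ler0n // -sqrtr_sqr ler_wsqrtr //.
    by rewrite -natrM -natrX ler_nat; move: nNN N1; clear; nia.
  rewrite powRM ?ler0n // ler_wpM2r ?powR_ge0 //.
  by rewrite -[leRHS]powRr1 // ler_powR ?ler1n // invf_le1 // ltW.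
have [T [hTC hTd hTs hTw hTf]] := hT N NTN.
apply: (hSN N NSN).
have Ts : (circuit_size T <= n)%N.
  by apply: leq_trans hTs _; apply: leq_trans (hNs N NsN) _.
have Tw : fan_in_le T n.
  apply: sub_all hTw => g /leq_trans; apply; exact: leq_trans (hNw N NwN) _.
have Nn : (N <= n)%N by apply: leq_trans NNn; case: (N) => // N'; rewrite leq_pmulr.
have [||S [Ssize Sf]] := @sym_and_of_TC0 N n m d c K T C (f N) m1 isT hTC Tw hTd hTf hC hd hM.
- rewrite -(ler_nat R); apply: le_trans E2K.
  have -> : expR (2 * x) = expR x * expR x by rewrite -expRD -mulr2n mulr_natl.
  apply: (@le_trans _ _ (8 * n%:R ^+ 2 * expR x)); last first.
    by rewrite ler_wpM2r ?expR_ge0.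
  rewrite !natrD natrM natrD.
  apply: (@le_trans _ _ (2 + (n%:R + n%:R) + n%:R * (n%:R + expR x))).
    apply: lerD; first by rewrite !lerD ?ler_nat.
    by apply: ler_pM; rewrite ?addr_ge0 ?ler0n ?ler_nat // lerD // ltW.
  move: nR1 E1; move: (n%:R : R) (expR x); clear => y E y1 E1.
  have h1 : y <= y * y by rewrite ler_peMr // (le_trans ler01).
  have h2 : y * y <= y * y * E by rewrite ler_peMr // mulr_ge0 // (le_trans ler01).
  have h3 : y * E <= y * y * E by rewrite ler_wpM2r // (le_trans ler01).
  by rewrite expr2 mulrDr; lra.
- rewrite -(ler_nat R); apply: le_trans E2K.
  rewrite natrX natrM ea -/r -/e.
  have E2 : expR x <= expR (2 * x).
    by rewrite ler_expR mulr_natl mulr2n lerDl (le_trans ler01 x1).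
  have nsq : n%:R <= n%:R ^+ 2 :> R by rewrite expr2 ler_peMr // ler0n.
  have t0 : 0 <= (a%:R * K%:R) ^+ e :> R by rewrite exprn_ge0 // mulr_ge0 ?ler0n.
  apply: le_trans E2; apply: le_trans n2E.
  apply: (@le_trans _ _ (3 * (a%:R * K%:R) ^+ e)); first by rewrite ler_peMl // ler1n.
  apply: (le_trans zK); apply: (le_trans zn); apply: (le_trans nsq).
  by rewrite ler_peMl ?ler1n // exprn_ge0 // ler0n.
exists S; split=> //; move: Ssize; rewrite -(ler_nat R) => /le_trans; apply.
rewrite pow2_expR ler_expR; apply: le_trans zN; apply: le_trans zK.
rewrite ea -/r -/e natrM natrX natrM.
by rewrite ler_piMr // mulr_ge0 ?ler0n // exprn_ge0 // mulr_ge0 ?ler0n.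
Qed.
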